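(* Let $\mathscr{M}=(\mathsf{M},\tau,\mathfrak{m})$ and $\mathscr{M}'=(\mathsf{M}',\tau',\mathfrak{m}')$ be normalized bounded Lorentzian metric measure spaces. Let $(X_i)_{i\in\mathbf{N}}$ be i.i.d. $\mathsf{M}$-valued random variables with law $\mathfrak{m}$ and $(X_i')_{i\in\mathbf{N}}$ be i.i.d. $\mathsf{M}'$-valued random variables with law $\mathfrak{m}'$, all defined on a common probability space $(\Omega,\mathscr{F},\mathbf{P})$. Then $\mathscr{M}$ and $\mathscr{M}'$ are isomorphic if and only if for every $k\in\mathbf{N}$ the random matrices $\mathsf{T}^k(X_1,\dots,X_k)$ and $\mathsf{T}'^k(X_1',\dots,X_k')$ coincide in law, i.e. $$\mathsf{T}^k(X_1,\dots,X_k)_\sharp\mathbf{P}=\mathsf{T}'^k(X_1',\dots,X_k')_\sharp\mathbf{P}.$$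
   Context: A bounded Lorentzian metric space is a pair $(\mathsf{M},\tau)$ of a nonempty set $\mathsf{M}$ and a function $\tau\colon\mathsf{M}^2\to[0,\infty)$ such that: (a) $\tau(x,y)+\tau(y,z)\le\tau(x,z)$ whenever $\tau(x,y)>0$ and $\tau(y,z)>0$; (b) there is a topology $T$ on $\mathsf{M}$ such that $\tau$ is continuous for the product topology $T^2$ and $\{\tau\ge\varepsilon\}\subset\mathsf{M}^2$ is compact for every $\varepsilon>0$; (c) for all distinct $x,y\in\mathsf{M}$ there is $z\in\mathsf{M}$ with $\tau(x,z)\ne\tau(y,z)$ or $\tau(z,x)\neq\tau(z,y)$. All topological and Borel notions on $\mathsf{M}$ refer to the coarsest topology satisfying (b), which exists and is Polish. A normalized bounded Lorentzian metric measure space is a triple $\mathscr{M}=(\mathsf{M},\tau,\mathfrak{m})$ with $(\mathsf{M},\tau)$ a bounded Lorentzian metric space and $\mathfrak{m}$ a Borel probability measure on $\mathsf{M}$ (not necessarily of full support). Isomorphy. The spacelike boundary $i^0$ of a bounded Lorentzian metric space is the (unique, if it exists) point with $\tau(i^0,x)=\tau(x,i^0)=0$ for every $x$. On $\mathrm{spt}\,\mathfrak{m}$ define $x\sim y$ if $\tau(x,z)=\tau(y,z)$ and $\tau(z,x)=\tau(z,y)$ for every $z\in\mathrm{spt}\,\mathfrak{m}$. Let $q\colon\mathrm{spt}\,\mathfrak{m}\to\tilde{\mathsf{M}}$ be the quotient projection and $\tilde\tau(q(x),q(y)):=\tau(x,y)$; then $(\tilde{\mathsf{M}},\tilde\tau)$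 is a bounded Lorentzian metric space (the distance quotient), and $\mathrm{spt}\,q_\sharp\mathfrak{m}=\tilde{\mathsf{M}}$, where $\sharp$ denotes push-forward. Write $\mathrm{spt}\,q_\sharp\mathfrak{m}\cup\{i^0\}$ for this space itself if it already has a spacelike boundary, and otherwise for the bounded Lorentzian metric space obtained by adjoining an abstract point $i^0$ and extending $\tilde\tau$ by zero to pairs involving $i^0$. Use primes for the analogous objects of $\mathscr{M}'$. $\mathscr{M}$ and $\mathscr{M}'$ are isomorphic if there is a Borel measurable map $\iota\colon\mathrm{spt}\,q_\sharp\mathfrak{m}\cup\{i^0\}\to\mathrm{spt}\,q'_\sharp\mathfrak{m}'\cup\{i'^0\}$ which is distance-preserving, i.e. $\tilde\tau(x,y)=\tilde\tau'(\iota(x),\iota(y))$ for all $x,y$, and satisfies $\iota_\sharp(q_\sharp\mathfrak{m})=q'_\sharp\mathfrak{m}'$. For $k\in\mathbf{N}$, $\mathsf{T}^k\colon\mathsf{M}^k\to\mathbf{R}^{k\times k}$ is defined by $\mathsf{T}^k(x_1,\dots,x_k)_{ij}:=\tau(x_i,x_j)$, and $\mathsf{T}'^k\colon\mathsf{M}'^k\to\mathbf{R}^{k\times k}$ is defined analogously with $\tau'$. *)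

(* Defs.v *)
From HB Require Import structures.
From mathcomp Require Import all_boot all_order all_algebra finmap.
From mathcomp Require Import all_classical all_reals all_analysis.

Set Implicit Arguments.
Unset Strict Implicit.
Unset Printing Implicit Defensive.

Import Order.TTheory GRing.Theory Num.Theory.
Import numFieldNormedType.Exports.

Local Open Scope classical_set_scope.
Local Open Scope ring_scope.
Local Open Scope quotient_scope.

(** Topologies on a fixed set, as first-class objects: the definition of a
    bounded Lorentzian metric space quantifies over them. *)

Record topology (M : Type) := Topology {
  opens : set (set M) ;
  opens_setT : opens setT ;
  opens_setI : forall A B, opens A -> opens B -> opens (A `&` B) ;
  opens_bigcup : forall F : set (set M),
    F `<=` opens -> opens (\bigcup_(A in F) A) }.

Definition topologized (M : Type) (T : topology M) : Type := M.

Section topologized.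
Variables (M : choiceType) (T : topology M).

Let opens_bigU (I : Type) (f : I -> set M) :
  (forall i, opens T (f i)) -> opens T (\bigcup_i f i).
Proof.
move=> Tf; have -> : \bigcup_i f i = \bigcup_(A in range f) A.
  by rewrite bigcup_image.
by apply: opens_bigcup => _ [i _ <-]; exact: Tf.
Qed.

HB.instance Definition _ := Choice.on (topologized T).
HB.instance Definition _ := @isOpenTopological.Build (topologized T)
  (opens T) (opens_setT T) (@opens_setI _ T) opens_bigU.

End topologized.

Section lorentzian.
Variable R : realType.

Definition admissible_topology (M : choiceType) (tau : M -> M -> R)
    (T : topology M) : Prop :=
  continuous (fun p : topologized T * topologized T => tau p.1 p.2 : R) /\
  (forall eps : R, 0 < eps ->
    compact [set p : topologized T * topologized T | eps <= tau p.1 p.2]).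

Definition bounded_lorentzian (M : pointedType) (tau : M -> M -> R) : Prop :=
  [/\ forall x y, 0 <= tau x y,
      forall x y z, 0 < tau x y -> 0 < tau y z ->
        tau x y + tau y z <= tau x z,
      exists T : topology M, admissible_topology tau T &
      forall x y, x != y ->
        exists z, tau x z != tau y z \/ tau z x != tau z y].

(** The coarsest admissible topology, defined for every [tau] as the
    intersection of all admissible topologies. *)
Definition lorentz_open (M : choiceType) (tau : M -> M -> R) : set (set M) :=
  [set U | forall T : topology M, admissible_topology tau T -> opens T U].

Lemma lorentz_open_coarsest (M : choiceType) (tau : M -> M -> R)
    (T : topology M) :
  admissible_topology tau T ->
  (forall T' : topology M, admissible_topology tau T' ->
    opens T `<=` opens T') ->
  lorentz_open tau = opens T.
Proof.
move=> aT minT; apply/seteqP; split=> [U /(_ _ aT)//|U TU T' aT'].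
exact: minT aT' _ TU.
Qed.

Definition lborel (M : pointedType) (tau : M -> M -> R) :=
  g_sigma_algebraType (lorentz_open tau).

Record lorentzian_mmspace := LorentzianMMSpace {
  carrier :> pointedType ;
  tau : carrier -> carrier -> R ;
  tau_bounded_lorentzian : bounded_lorentzian tau ;
  refmeas : probability (lborel tau) R }.

Definition spt (M : lorentzian_mmspace) : set M :=
  [set x | forall U : set M,
    lorentz_open (@tau M) U -> U x -> (0 < refmeas M U)%E].

Section distance_quotient.
Variable M : lorentzian_mmspace.

Definition spt_equiv : rel (set_type (@spt M)) :=
  fun x y => `[< forall z : set_type (@spt M),
    tau (val x) (val z) = tau (val y) (val z) /\
    tau (val z) (val x) = tau (val z) (val y) >].

Let spt_equiv_refl : reflexive spt_equiv.
Proof. by move=> x; apply/asboolP. Qed.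

Let spt_equiv_sym : symmetric spt_equiv.
Proof. by move=> x y; apply: asbool_equiv_eq; split=> h z; have [-> ->] := h z. Qed.

Let spt_equiv_trans : transitive spt_equiv.
Proof.
move=> y x z /asboolP xy /asboolP yz; apply/asboolP => t.
by have [-> ->] := xy t; exact: yz.
Qed.

Canonical spt_equiv_rel :=
  EquivRel spt_equiv spt_equiv_refl spt_equiv_sym spt_equiv_trans.

Definition distance_quotient : choiceType := {eq_quot spt_equiv_rel}.

Definition quotient_proj (x : set_type (@spt M)) : distance_quotient :=
  \pi_{eq_quot spt_equiv_rel} x.

Definition quotient_tau (a b : distance_quotient) : R :=
  tau (val (repr (a : {eq_quot spt_equiv_rel})))
      (val (repr (b : {eq_quot spt_equiv_rel}))).

Lemma quotient_tauE x y :
  quotient_tau (quotient_proj x) (quotient_proj y) = tau (val x) (val y).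
Proof.
rewrite /quotient_tau /quotient_proj.
have /eqmodP/asboolP/= hx :=
  reprK (\pi_{eq_quot spt_equiv_rel} x : {eq_quot spt_equiv_rel}).
have /eqmodP/asboolP/= hy :=
  reprK (\pi_{eq_quot spt_equiv_rel} y : {eq_quot spt_equiv_rel}).
by have [-> _] := hx (repr (\pi_{eq_quot spt_equiv_rel} y)); have [_ ->] := hy x.
Qed.

End distance_quotient.

Definition spacelike_boundary (Q : Type) (t : Q -> Q -> R) (i0 : Q) : Prop :=
  forall x, t i0 x = 0 /\ t x i0 = 0.

(** [Q] with a spacelike boundary adjoined if needed: [None] is the abstract
    new point, and it belongs to the type only when [Q] has no spacelike
    boundary of its own. *)
Section augmentation.
Variables (Q : choiceType) (t : Q -> Q -> R).

Definition augmented_set : set (option Q) :=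
  [set o | o = None -> ~ exists i0, spacelike_boundary t i0].

Definition augmented : Type := set_type augmented_set.

Lemma augmented_set_Some (x : Q) : Some x \in augmented_set.
Proof. exact/mem_set. Qed.

Definition augment (x : Q) : augmented := exist _ (Some x) (augmented_set_Some x).

Definition augmented_tau (a b : augmented) : R :=
  match \val a, \val b with Some x, Some y => t x y | _, _ => 0 end.

HB.instance Definition _ := Choice.on augmented.

Lemma augmented_boundary :
  exists i0 : augmented, spacelike_boundary augmented_tau i0.
Proof.
have [[i0 i0P]|no_i0] := pselect (exists i0, spacelike_boundary t i0).
  by exists (augment i0) => -[[x|] ?]; rewrite /augmented_tau /=.
have Noneaug : None \in augmented_set by exact/mem_set.
by exists (exist _ None Noneaug) => -[[x|] ?].
Qed.

HB.instance Definition _ :=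
  isPointed.Build augmented (projT1 (cid augmented_boundary)).

End augmentation.

(** The space spt q_# m \cup {i^0}, its time separation, and q_# m seen as a
    measure on it. *)
Definition reduced (M : lorentzian_mmspace) : pointedType :=
  augmented (@quotient_tau M).

Definition reduced_tau (M : lorentzian_mmspace) :
  reduced M -> reduced M -> R := @augmented_tau _ (@quotient_tau M).

Definition reduced_meas (M : lorentzian_mmspace) :
    set (lborel (@reduced_tau M)) -> \bar R :=
  fun A => refmeas M
    (val @` [set x : set_type (@spt M) |
              A (augment (@quotient_tau M) (quotient_proj x))]).

Definition isomorphic (M M' : lorentzian_mmspace) : Prop :=
  exists iota : lborel (@reduced_tau M) -> lborel (@reduced_tau M'),
    [/\ measurable_fun setT iota,
        forall x y, reduced_tau x y = reduced_tau (iota x) (iota y) &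
        forall A, measurable A ->
          pushforward (@reduced_meas M) iota A = reduced_meas A].

Definition tau_mx (M : lorentzian_mmspace) (k : nat) (x : 'I_k -> M) :
  'M[R]_k := \matrix_(i, j) tau (x i) (x j).

Definition borel_mx (k : nat) := g_sigma_algebraType (@open 'M[R]_k).

Section probability_notions.
Context (d d' : measure_display) (Omega : measurableType d)
  (E : measurableType d') (P : probability Omega R).

Definition mutually_independent (X : nat -> {RV P >-> E}) : Prop :=
  forall (J : {fset nat}) (B : nat -> set E), (forall i, measurable (B i)) ->
    P (\bigcap_(i in [set` J]) (X i @^-1` B i)) =
    (\prod_(i <- J) P (X i @^-1` B i))%E.

Definition iid_with_law (X : nat -> {RV P >-> E}) (m : probability E R) :
    Prop :=
  mutually_independent X /\
  (forall i A, measurable A -> distribution P (X i) A = m A).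

Definition eq_in_law (Y Z : Omega -> E) : Prop :=
  forall A, measurable A -> pushforward P Y A = pushforward P Z A.

End probability_notions.

End lorentzian.

(* Main.v *)
Require Import Defs.
From HB Require Import structures.
From mathcomp Require Import all_boot all_order all_algebra finmap.
From mathcomp Require Import all_classical all_reals all_analysis.
From mathcomp Require Import measurable_realfun lra.

(** Call x and y e-close when t(x,.) and t(y,.), as well as t(.,x) and t(.,y),
    differ by at most e uniformly. In an admissible topology {t >= e} is compact,
    so by the tube lemma the points e-close to x form a neighbourhood of x;
      hence
    e-closeness defines the coarsest admissible topology. With the spacelike
    boundary adjoined, the reduced space is compact for it: an ultrafilter either
    contains the projection of some {t >= e} or converges to the boundary.

    An isomorphism transports the i.i.d. sequence of the first space to one with
    the law of the second, and the matrices are measurable functions of these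
    sequences. Conversely, the weak law of large numbers provides events of
    probability at least 2/3 on which a long sample is e-dense and has almost
    correct empirical frequencies on finitely many sets. As the matrices have
    equal laws, two such samples, one in each space, have almost equal matrices;
    matching them index by index gives approximate isomorphisms, whose limit
    along an ultrafilter is uniform and is an isomorphism. *)

Set Implicit Arguments.
Unset Strict Implicit.
Unset Printing Implicit Defensive.

Import Order.TTheory GRing.Theory Num.Theory.
Import numFieldNormedType.Exports.

Local Open Scope classical_set_scope.
Local Open Scope ring_scope.

(** If [A] lies in a finer filter [G] but its preimage is missing from [U], then the preimage of the
    complement is in [U], and [G] contains two disjoint sets. *)
Lemma ultra_fmap (I J : Type) (f : I -> J) (U : set_system I) :
  UltraFilter U -> UltraFilter (f @ U).
Proof.
move=> UU; split; first exact: fmap_proper_filter.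
move=> G GF UG; apply/seteqP; split=> // A GA.
have [//|UnA] := in_ultra_setVsetC (f @^-1` A) UU.
by have [x []] := filter_ex (filterI GA (UG (~` A) UnA)).
Qed.

(** * Uniform closeness and its topology *)

Section close.
Variables (R : realType) (M : choiceType) (t : M -> M -> R).

Definition close (e : R) (x y : M) : Prop :=
  forall z, `|t x z - t y z| <= e /\ `|t z x - t z y| <= e.

Lemma close_refl e x : 0 <= e -> close e x x.
Proof. by move=> e0 z; rewrite !subrr normr0. Qed.

Lemma close_sym e x y : close e x y -> close e y x.
Proof. by move=> xy z; rewrite distrC (distrC (t z y)); exact: xy. Qed.

Lemma close_le e e' x y : e <= e' -> close e x y -> close e' x y.
Proof. by move=> ee' xy z; have [h1 h2] := xy z; split; apply: le_trans ee'. Qed.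

Lemma close_trans e e' y x z :
  close e x y -> close e' y z -> close (e + e') x z.
Proof.
move=> xy yz w; have [h1 h2] := xy w; have [h3 h4] := yz w.
by split; apply: (le_trans (ler_distD (t _ _) _ _)); apply: lerD; eassumption.
Qed.

Lemma close_dist e x x' y y' :
  close e x x' -> close e y y' -> `|t x y - t x' y'| <= e + e.
Proof.
move=> xx' yy'; apply: (le_trans (ler_distD (t x' y) _ _)).
by apply: lerD; [exact: (xx' y).1|exact: (yy' x').2].
Qed.

Lemma boundary_close e x y : 0 <= e ->
  spacelike_boundary t x -> spacelike_boundary t y -> close e x y.
Proof.
move=> e0 bx b_y z; have [-> ->] := bx z; have [-> ->] := b_y z.
by rewrite subrr normr0.
Qed.

Definition close_open : set (set M) :=
  [set U | forall x, U x -> exists2 e : R, 0 < e & forall y, close e x y -> U y].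

Lemma close_openT : close_open setT.
Proof. by move=> x _; exists 1. Qed.

Lemma close_openI A B : close_open A -> close_open B -> close_open (A `&` B).
Proof.
move=> oA oB x [/oA[e e0 eA] /oB[f f0 fB]]; exists (Num.min e f) => [|y xy].
  by rewrite lt_min e0.
by split; [apply: eA|apply: fB]; apply: close_le xy; rewrite ge_min lexx ?orbT.
Qed.

Lemma close_open_bigcup (F : set (set M)) :
  F `<=` close_open -> close_open (\bigcup_(A in F) A).
Proof.
move=> oF x [A FA /(oF _ FA)[e e0 eA]]; exists e => // y xy.
by exists A => //; exact: eA.
Qed.

Definition close_topology : topology M :=
  Topology close_openT close_openI close_open_bigcup.

(** The strict bound [e < r] makes thickenings open, whereas a [close] ball is closed. Both kinds
    are therefore Borel. *)
Definition thickening (r : R) (C : set M) : set M :=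
  [set y | exists2 c, C c & exists2 e : R, e < r & close e c y].

Lemma close_open_thickening r C : close_open (thickening r C).
Proof.
move=> y [c Cc [e er cy]]; exists ((r - e) / 2); first by lra.
move=> z yz; exists c => //; exists (e + (r - e) / 2); first by lra.
exact: close_trans cy yz.
Qed.

Lemma close_thickening r e c C y : e < r -> C c -> close e c y ->
  thickening r C y.
Proof. by move=> er Cc cy; exists c => //; exists e. Qed.

(** A witness [z] against closeness exceeds [r] by a positive amount, and moving [y] by half of it
    keeps [z] a witness. *)
Lemma close_open_not_close r x : close_open [set y | ~ close r x y].
Proof.
move=> y /existsNP[z /not_andP[]/negP]; rewrite -ltNge => h.
- exists ((`|t x z - t y z| - r) / 2); first by lra.
  move=> y' /(_ z)[yy' _] /(_ z)[xy' _].
  have := ler_distD (t y' z) (t x z) (t y z).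
  by rewrite (distrC (t y' z)); lra.
- exists ((`|t z x - t z y| - r) / 2); first by lra.
  move=> y' /(_ z)[_ yy'] /(_ z)[_ xy'].
  have := ler_distD (t z y') (t z x) (t z y).
  by rewrite (distrC (t z y')); lra.
Qed.

Lemma close_topology_nbhsP (x : M) (A : set M) :
  nbhs (x : topologized close_topology) A <->
  exists2 e : R, 0 < e & forall y, close e x y -> A y.
Proof.
rewrite nbhsE; split=> [[U [oU Ux] UA]|[e e0 eA]].
  have [e e0 eU] := oU _ Ux; exists e => // y /eU; exact: UA.
exists (thickening e [set x]).
  split; first exact: close_open_thickening.
  by apply: (@close_thickening _ 0) => //; exact: close_refl.
by move=> y [_ -> [e' e'e xy]]; apply: eA; apply: close_le xy; exact: ltW.
Qed.

Lemma close_topology_continuous :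
  continuous (fun p : topologized close_topology * topologized close_topology =>
    t p.1 p.2 : R).
Proof.
move=> [x y]; apply/cvgrPdist_le => e e0 /=.
have e20 : 0 < e / 2 by lra.
exists (close (e / 2) x, close (e / 2) y) => /=.
  by split; apply/close_topology_nbhsP; exists (e / 2).
by move=> [x' y'] /= [xx' yy']; have := close_dist xx' yy'; lra.
Qed.

End close.

(** * Admissible topologies: the coarsest one, ultrafilter limits, separability *)

Section admissible.
Variables (R : realType) (M : choiceType) (t : M -> M -> R).
Hypothesis t_ge0 : forall x y, 0 <= t x y.

(* Outside the compact set {t >= e} both values lie in [0, e); on it, apply the
   tube lemma. *)
Lemma admissible_nbhs_close (T : topology M) (e : R) (x : M) : 0 < e ->
  admissible_topology t T -> nbhs (x : topologized T) (close t e x).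
Proof.
move=> e0 [ct /(_ _ e0) cK].
pose TT := topologized T.
have ct' (f g : TT * (TT * TT) -> TT) (c : TT * TT) :
    {for (x : TT, c), continuous f} -> {for (x : TT, c), continuous g} ->
    {for (x : TT, c), continuous (fun q => t (f q) (g q))}.
  move=> cf cg; apply: (@cvg_comp _ _ _ (fun q => (f q, g q))
    (fun p : TT * TT => t p.1 p.2 : R) _
    (nbhs (f (x : TT, c), g (x : TT, c))));
      last exact: (ct (f (x : TT, c), g (x : TT, c))).
  exact: (cvg_pair cf cg).
have c1 (c : TT * TT) : {for (x : TT, c), continuous (fun q : TT * (TT * TT) => q.1)}.
  exact: cvg_fst.
have c21 (c : TT * TT) :
    {for (x : TT, c), continuous (fun q : TT * (TT * TT) => q.2.1)}.
  by apply: (@cvg_comp _ _ _ snd fst _ (nbhs c));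
    [exact: cvg_snd|exact: cvg_fst].
have c22 (c : TT * TT) :
    {for (x : TT, c), continuous (fun q : TT * (TT * TT) => q.2.2)}.
  by apply: (@cvg_comp _ _ _ snd snd _ (nbhs c));
    [exact: cvg_snd|exact: cvg_snd].
have ccst (c : TT * TT) :
    {for (x : TT, c), continuous (fun q : TT * (TT * TT) => x : TT)}.
  exact: cvg_cst.
have step (u v : TT -> TT * TT -> R) :
    (forall c, u x c = v x c) ->
    (forall c, {for (x : TT, c), continuous (fun q => u q.1 q.2)}) ->
    (forall c, {for (x : TT, c), continuous (fun q => v q.1 q.2)}) ->
    \forall y \near (x : TT), forall c, e <= t c.1 c.2 -> `|u y c - v y c| <= e.
  move=> uv cu cv.
  have := (compact_near_coveringP _).1 cK TT (nbhs (x : TT))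
    (fun y c => `|u y c - v y c| <= e) _.
  apply => c _ /=.
  have cuv : {for (x : TT, c), continuous (fun q => u q.1 q.2 - v q.1 q.2)}.
    by apply: cvgB; [exact: cu|exact: cv].
  have /cvgrPdist_le/(_ e e0) := cuv.
  rewrite /= uv subrr; under eq_near do rewrite sub0r normrN.
  by case=> -[A B] /= [nA nB] AB; exists (B, A) => //= -[c' y] [? ?];
    exact: (AB (y, c')).
have h1 := step (fun y c => t y c.2) (fun y c => t x c.2) (fun=> erefl)
  (fun c => ct' _ _ _ (c1 c) (c22 c)) (fun c => ct' _ _ _ (ccst c) (c22 c)).
have h2 := step (fun y c => t c.1 y) (fun y c => t c.1 x) (fun=> erefl)
  (fun c => ct' _ _ _ (c21 c) (c1 c)) (fun c => ct' _ _ _ (c21 c) (ccst c)).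
have small (a b : R) : 0 <= a -> 0 <= b -> a < e -> b < e -> `|a - b| <= e.
  by move=> *; rewrite ler_norml; lra.
near=> y => z; split.
- have [h|h] := leP e (t x z).
    by rewrite distrC; apply: (near h1 y _ (x, z) h).
  have [h'|h'] := leP e (t y z); last exact: small.
  by rewrite distrC; apply: (near h1 y _ (y, z) h').
- have [h|h] := leP e (t z x).
    by rewrite distrC; apply: (near h2 y _ (z, x) h).
  have [h'|h'] := leP e (t z y); last exact: small.
  by rewrite distrC; apply: (near h2 y _ (z, y) h').
Unshelve. all: by end_near. Qed.

Lemma admissible_close_open (T : topology M) : admissible_topology t T ->
  close_open t `<=` opens T.
Proof.
move=> aT U oU; have : open (U : set (topologized T)); last by [].
rewrite openE => x /oU[e e0 eU]; rewrite /interior /=.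
by apply: filterS eU _; exact: admissible_nbhs_close.
Qed.

(** The identity from [T] to the coarser closeness topology is continuous, so compactness of the
    superlevel sets passes to the image. *)
Lemma admissible_close_topology (T : topology M) : admissible_topology t T ->
  admissible_topology t (close_topology t).
Proof.
move=> aT; split; first exact: close_topology_continuous.
move=> e e0; have [_ /(_ _ e0) cK] := aT.
have ci : continuous (id : topologized T -> topologized (close_topology t)).
  apply/continuousP => A oA; exact: (admissible_close_open aT oA).
pose f (p : topologized T * topologized T) :
  topologized (close_topology t) * topologized (close_topology t) := (p.1, p.2).
have cf : continuous f.
  move=> [a b]; apply: (@cvg_pair _ _ _ _ (nbhs _) (nbhs _)).
    by apply: cvg_comp (ci a); exact: cvg_fst.
  by apply: cvg_comp (ci b); exact: cvg_snd.
have := continuous_compact (continuous_subspaceT cf) cK.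
congr compact.
by apply/seteqP; split=> [_ [[a b] ? <-]//|[a b] ab]; exists (a, b).
Qed.

Lemma lorentz_openE : (exists T, admissible_topology t T) ->
  lorentz_open t = close_open t.
Proof.
move=> [T aT]; rewrite -[close_open t]/(opens (close_topology t)).
apply: lorentz_open_coarsest; first exact: admissible_close_topology aT.
by move=> T' aT'; exact: admissible_close_open.
Qed.

(** Either the points converge, or they escape to a virtual spacelike boundary. If they do not
    escape, then for some [e] almost every [y i] is a coordinate of a point of the compact set where
    [t] is at least [e]. *)
Lemma admissible_ultra_lim (I : Type) (U : set_system I) (y : I -> M) :
  UltraFilter U -> (exists T, admissible_topology t T) ->
  (exists x, forall e : R, 0 < e -> U [set i | close t e x (y i)]) \/
  (forall e : R, 0 < e -> U [set i | forall z, t (y i) z < e /\ t z (y i) < e]).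
Proof.
move=> UU [T aT]; apply/or_asboolP; rewrite -implyNb;
  apply/implyP => /asboolP nl.
apply/asboolP => e e0; apply: contrapT => nU.

have [//|/= U'] := in_ultra_setVsetC
  [set i | forall z, t (y i) z < e /\ t z (y i) < e] UU.
(* A compactness limit [p] of the pairs [f i] projects under [g] to a limit of the points [y i],
   which [nl] excludes. *)
have key (f : I -> topologized T * topologized T) (g : topologized T * topologized T -> topologized T) :
   (forall i, g (f i) = y i) -> (forall p, g @ p --> g p) ->
   U [set i | e <= t (f i).1 (f i).2] -> False.
  move=> gf cg Uf; have := aT.2 _ e0;
    rewrite compact_ultra => /(_ _ (ultra_fmap f UU) Uf).
  case=> p [_ fp]; apply: nl; exists (g p) => r r0.
  have := cvg_comp _ _ fp (cg p) _ (admissible_nbhs_close (g p) r0 aT).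
  suff -> : [set i | close t r (g p) (y i)] =
    f @^-1` (g @^-1` close t r (g p)) by exact.
  by apply/funext => i /=; rewrite gf.
have ex i : exists w : M, (exists w, e <= t (y i) w \/ e <= t w (y i)) ->
    e <= t (y i) w \/ e <= t w (y i).
  have [[w h]|h] := pselect (exists w, e <= t (y i) w \/ e <= t w (y i)).
    by exists w.
  by exists (y i) => /h.
have [z zP] := choice ex.
have [Uz|Uz] := in_ultra_setVsetC [set i | e <= t (y i) (z i)] UU.
  by apply: (key (fun i => (y i, z i)) fst) => // p; exact: cvg_fst.
apply: (key (fun i => (z i, y i)) snd) => // [p|]; first exact: cvg_snd.
apply: filterS2 U' Uz => i /= nall /negP; rewrite -ltNge => lt.
have [|h|//] := zP i; last by move: lt; rewrite ltNge h.
apply: contrapT => no; apply: nall => w; rewrite !ltNge.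
by split; apply/negP => h; apply: no; exists w; tauto.
Qed.

(** If every finite list leaves some point uncovered, the uncovered sets generate a proper filter.
    An ultrafilter above it has neither a limit [x], by the list [[:: x]], nor an escape to the
    boundary, by the empty list. *)
Lemma admissible_totally_bounded (e : R) : 0 < e ->
  (exists T, admissible_topology t T) ->
  exists s : seq M, forall x, (exists2 a, a \in s & close t e a x) \/
    (forall z, t x z < e /\ t z x < e).
Proof.
move=> e0 aT; apply: contrapT => /forallNP noS.
pose unc (s : seq M) := [set x | ~ ((exists2 a, a \in s & close t e a x) \/
  (forall z, t x z < e /\ t z x < e))].
have FF : ProperFilter (filter_from [set: seq M] unc).
  apply: filter_from_proper => [|s _]; last exact/existsNP/noS.
  apply: filter_from_filter; first by exists [::].
  move=> s1 s2 _ _; exists (s1 ++ s2) => // x /= nx; split=> -[[a as_ ax]|b].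
  - by apply: nx; left; exists a => //; rewrite mem_cat as_.
  - by apply: nx; right.
  - by apply: nx; left; exists a => //; rewrite mem_cat as_ orbT.
  - by apply: nx; right.
have [U [UU FU]] := ultraFilterLemma FF.
have Uunc s : U (unc s) by apply: FU; exists s.
have [[x /(_ _ e0) Ux]|/(_ _ e0) Ub] := admissible_ultra_lim id UU aT.
  have [y [xy]] := filter_ex (filterI Ux (Uunc [:: x])); apply; left.
  by exists x => //; rewrite inE.
by have [y [yb]] := filter_ex (filterI Ub (Uunc [::])); apply; right.
Qed.

Lemma admissible_dense : M -> (exists T, admissible_topology t T) ->
  exists a : nat -> M, forall (e : R) x, 0 < e -> exists n, close t e (a n) x.
Proof.
move=> x0 aT.
have h n : 0 < n.+1%:R^-1 :> R by rewrite invr_gt0 ltr0n.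
have [s sP] := choice (fun n => admissible_totally_bounded (h n) aT).
(* Out-of-range indices of the nets return [b], which is a boundary point as soon as one exists; any
   two boundary points are close. *)
pose b := xget x0 (spacelike_boundary t).
exists (fun n => if choice.unpickle n is Some (i, j) then nth b (s i) j else b) => e x e0.
have [bx|nbx] := pselect (spacelike_boundary t x).
  exists (choice.pickle (0, size (s 0))%N);
    rewrite choice.pickleK nth_default//.
  apply: boundary_close => //; first exact: ltW.
  by rewrite /b; case: xgetP => // /(_ x).
have [z zP] : exists z, 0 < t x z \/ 0 < t z x.
  apply: contrapT => h'; apply: nbx => z; split; apply/eqP;
    by rewrite eq_le t_ge0 andbT leNgt; apply/negP => ?; apply: h'; exists z;
      tauto.
(* A net finer than a positive value of [t] at [x] rules out the alternative that [x] has only small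
   values. *)
pose r := Num.min e (if 0 < t x z then t x z else t z x).
have r0 : 0 < r by rewrite lt_min e0; case: ifPn => //; case: zP => [->|].
have [n] := ltr_add_invr r0; rewrite add0r => nr.
have [[a /(nthP b)[j js <-] ax]|/(_ z)[h1 h2]] := sP n x.
  exists (choice.pickle (n, j)); rewrite choice.pickleK; apply: close_le ax.
  by rewrite (le_trans (ltW nr))// ge_min lexx.
move: nr; rewrite lt_min; case: ifPn => _ /andP[_ lt].
- by have := lt_trans lt h1; rewrite ltxx.
- by have := lt_trans lt h2; rewrite ltxx.
Qed.

End admissible.

(** * Measurability of the matrix map *)

Section kernel_mx.
Variables (R : realType) (N : pointedType) (t : N -> N -> R).
Hypothesis t_ge0 : forall x y, 0 <= t x y.
Hypothesis t_adm : exists T : topology N, admissible_topology t T.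

Lemma measurable_close_open (U : set N) :
  close_open t U -> measurable (U : set (lborel t)).
Proof.
by move=> oU; apply: sub_sigma_algebra; rewrite lorentz_openE.
Qed.

Lemma measurable_close (e : R) (x : N) : measurable (close t e x : set (lborel t)).
Proof.
rewrite -[X in measurable X]setCK; apply: measurableC.
by apply: measurable_close_open; exact: close_open_not_close.
Qed.

Lemma measurable_fun_lborel (d : measure_display) (W : measurableType d)
    (f : W -> lborel t) :
  (forall U, close_open t U -> measurable (f @^-1` U)) -> measurable_fun setT f.
Proof.
move=> mf; apply: (@measurability _ _ W (lborel t) setT f (lorentz_open t) erefl).
by move=> _ [U oU <-]; rewrite setTI; apply: mf; rewrite -lorentz_openE.
Qed.

Definition kernel_mx (k : nat) (x : 'I_k -> N) : 'M[R]_k :=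
  \matrix_(i, j) t (x i) (x j).

(** Boxes of closed balls with centres in a dense sequence and radii [m.+1%:R^-1] are countable in
    number. Those inside the preimage of [O] cover it, which exhibits the preimage as a countable
    union of measurable boxes. *)
Lemma open_kernel_mx_boxes (k : nat) (O : set 'M[R]_k) : open O ->
  exists (D : set nat) (B : nat -> 'I_k -> set N),
    (forall n i, measurable (B n i : set (lborel t))) /\
    forall x, O (kernel_mx x) <-> exists2 n, D n & forall i, B n i (x i).
Proof.
move=> oO; have [a aP] := admissible_dense t_ge0 point t_adm.
pose B (n : nat) (i : 'I_k) : set N :=
  if (choice.unpickle n : option ({ffun 'I_k -> nat} * nat)) is Some (f, m)
  then close t m.+1%:R^-1 (a (f i)) else set0.
exists [set n | forall x, (forall i, B n i (x i)) -> O (kernel_mx x)], B.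
split=> [n i|x].
  rewrite /B; case: choice.unpickle => [[f m]|]; first exact: measurable_close.
  exact: measurable0.
split=> [Ox|[n Dn /Dn//]].
have /nbhs_ballP[e /= e0 eO] : nbhs (kernel_mx x) O by exact: open_nbhs_nbhs.
(* Two points in a ball of radius below [e / 8] are [e / 4]-close, and changing both arguments moves
   an entry by at most [e / 2 < e]. *)
have e40 : 0 < e / 8 by lra.
have [m] := ltr_add_invr e40; rewrite add0r => me.
have m0 : 0 < m.+1%:R^-1 :> R by rewrite invr_gt0 ltr0n.
have [f fP] := choice (fun i => aP _ (x i) m0).
have Bx i y : B (choice.pickle (finfun f, m)) i y <-> close t m.+1%:R^-1 (a (f i)) y.
  by rewrite /B choice.pickleK ffunE.
exists (choice.pickle (finfun f, m)) => [y yB|i]; last exact/Bx.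
apply: eO; split=> // i j; rewrite !mxE.
have xy i' : close t (e / 4) (x i') (y i').
  have := close_trans (close_sym (fP i')) ((Bx _ _).1 (yB i')).
  by apply: close_le; apply: le_trans (lerD (ltW me) (ltW me)) _; lra.
by rewrite /ball /= (le_lt_trans (close_dist (xy i) (xy j)))//; lra.
Qed.

Lemma measurable_kernel_mx (d : measure_display) (W : measurableType d) (k : nat)
    (Z : 'I_k -> W -> lborel t) : (forall i, measurable_fun setT (Z i)) ->
  measurable_fun setT (fun w => kernel_mx (fun i => Z i w) : borel_mx R k).
Proof.
move=> mZ; apply: (@measurability _ _ W (borel_mx R k) setT _ (@open 'M[R]_k) erefl).
move=> _ [V /open_kernel_mx_boxes[D [B [mB OE]]] <-]; rewrite setTI.
have -> : (fun w => kernel_mx (fun i => Z i w)) @^-1` V =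
    \bigcup_(n in D) \bigcap_i (Z i @^-1` B n i).
  apply/seteqP; split=> w /= => [/OE[n Dn Bn]|[n Dn Bn]].
    by exists n => // i _; exact: Bn.
  by apply/OE; exists n => // i; exact: Bn.
apply: bigcup_measurable => n _; apply: fin_bigcap_measurable => // i _.
by rewrite -[X in measurable X]setTI; exact: mZ.
Qed.

End kernel_mx.

(** * Equality of laws tested on rectangles *)

Lemma eq_pushforward (R : realType) (d d' : measure_display)
    (W : measurableType d) (E : measurableType d') (P : probability W R)
    (G : set (set E)) (f g : W -> E) :
  @measurable _ E = <<s G >> -> setI_closed G -> G setT ->
  measurable_fun setT f -> measurable_fun setT g ->
  (forall A, G A -> P (f @^-1` A) = P (g @^-1` A)) ->
  forall A, measurable A -> P (f @^-1` A) = P (g @^-1` A).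
Proof.
move=> mG GI GT mf mg fg A mA.
pose F : {mfun W >-> E} := HB.pack f (isMeasurableFun.Build _ _ _ _ f mf).
pose H : {mfun W >-> E} := HB.pack g (isMeasurableFun.Build _ _ _ _ g mg).
apply: (measure_unique G (fun=> setT) mG GI (fun=> GT) _
  (distribution P F) (distribution P H)) => //; first by rewrite bigcup_const.
by move=> _; rewrite (@le_lt_trans _ _ 1%E) ?probability_le1 ?ltry.
Qed.

Lemma eq_law_kernel_mx (R : realType) (N : pointedType) (t : N -> N -> R)
    (d : measure_display) (W : measurableType d) (P : probability W R)
    (k : nat) (Z Z' : 'I_k -> W -> lborel t) :
  (forall x y, 0 <= t x y) ->
  (exists T : topology N, admissible_topology t T) ->
  (forall i, measurable_fun setT (Z i)) -> (forall i, measurable_fun setT (Z' i)) ->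
  (forall B : 'I_k -> set (lborel t), (forall i, measurable (B i)) ->
    P (\bigcap_i (Z i @^-1` B i)) = P (\bigcap_i (Z' i @^-1` B i))) ->
  forall A : set (borel_mx R k), measurable A ->
    P ((fun w => kernel_mx t (fun i => Z i w)) @^-1` A) =
    P ((fun w => kernel_mx t (fun i => Z' i w)) @^-1` A).
Proof.
move=> t_ge0 t_adm mZ mZ' ZZ' A mA.
pose rect (B : 'I_k -> set (lborel t)) : set ('I_k -> N) :=
  [set x | forall i, B i (x i)].
(* Measurable rectangles form a generating pi-system of [E], and the matrix map is measurable on
   [E]; hence agreement of the joint laws on rectangles is enough. *)
pose G : set (set ('I_k -> N)) :=
  [set S | exists2 B, (forall i, measurable (B i)) & S = rect B].
pose E := g_sigma_algebraType G.
have rectE (Y : 'I_k -> W -> lborel t) B :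
    (fun w i => Y i w) @^-1` rect B = \bigcap_i (Y i @^-1` B i).
  by apply/seteqP; split=> w /= h i; [move=> _; exact: h|exact: h].
have mcoord (Y : 'I_k -> W -> lborel t) : (forall i, measurable_fun setT (Y i)) ->
    measurable_fun setT ((fun w i => Y i w) : W -> E).
  move=> mY; apply: (@measurability _ _ W E setT _ G erefl).
  move=> _ [_ [B mB ->] <-]; rewrite setTI.
  rewrite rectE; apply: fin_bigcap_measurable => // i _.
  by rewrite -[X in measurable X]setTI; exact: mY.
have mproj i : measurable_fun setT (fun x : E => x i : lborel t).
  move=> _ B mB; rewrite setTI; apply: sub_sigma_algebra.
  exists (fun j => if j == i then B else setT) => [j|]; first by case: ifP.
  apply/seteqP; split=> x /= => [Bx j|/(_ i)]; last by rewrite eqxx.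
  by case: ifPn => // /eqP ->.
have mT := measurable_kernel_mx t_ge0 t_adm mproj.
have mTA : measurable ((fun x : E => kernel_mx t x : borel_mx R k) @^-1` A).
  by rewrite -[X in measurable X]setTI; exact: mT.
rewrite -[LHS]/(P (((fun w i => Z i w) : W -> E) @^-1`
  ((fun x : E => kernel_mx t x : borel_mx R k) @^-1` A))).
rewrite -[RHS]/(P (((fun w i => Z' i w) : W -> E) @^-1`
  ((fun x : E => kernel_mx t x : borel_mx R k) @^-1` A))).
apply: (@eq_pushforward _ _ _ W E P G) => //.
- move=> _ _ [B mB ->] [C mC ->]; exists (fun i => B i `&` C i).
    by move=> i; exact: measurableI.
  by apply/seteqP; split=> [x [? ?] i|x h]; [split|split=> i; have [] := h i].
- by exists (fun=> setT) => //; apply/seteqP; split.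
- exact: mcoord.
- exact: mcoord.
by move=> _ [B mB ->]; rewrite !rectE; exact: ZZ'.
Qed.

(** * The support of the reference measure *)

Section support.
Variables (R : realType) (M : lorentzian_mmspace R).
Local Notation sptM := (@spt R M).

Lemma tau_ge0 (x y : M) : 0 <= tau x y.
Proof. by have [] := tau_bounded_lorentzian M. Qed.

Lemma tau_admissible : exists T : topology M, admissible_topology (@tau R M) T.
Proof. by have [] := tau_bounded_lorentzian M. Qed.

(** Every point off the support has a null neighbourhood, which contains a null thickening from a
    countable family. The complement is thus a countable union of null open sets. *)
Lemma spt_setC_null : measurable (~` sptM : set (lborel (@tau R M))) /\
  refmeas M (~` sptM) = 0%E.
Proof.
have [a aP] := admissible_dense tau_ge0 point tau_admissible.
pose ball (i m : nat) : set M := thickening (@tau R M) m.+1%:R^-1 [set a i].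
have oball i m : close_open (@tau R M) (ball i m) by exact: close_open_thickening.
pose F (n : nat) : set (lborel (@tau R M)) :=
  if (choice.unpickle n : option (nat * nat)) is Some (i, m) then
    if refmeas M (ball i m) == 0%E then ball i m else set0 else set0.
have mF n : measurable (F n).
  rewrite /F; case: choice.unpickle => [[i m]|//]; case: ifP => // _.
  exact: (measurable_close_open tau_ge0 tau_admissible).
have F0 n : refmeas M (F n) = 0%E.
  rewrite /F; case: choice.unpickle => [[i m]|]; last exact: measure0.
  by case: ifPn => [/eqP//|_]; exact: measure0.
suff -> : ~` sptM = \bigcup_n F n.
  have mU : measurable (\bigcup_n F n) by exact: bigcupT_measurable.
  split=> //; apply/(negligibleP _ mU); apply: negligible_bigcup => n.
  by apply/(negligibleP _ (mF n)); exact: F0.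
apply/seteqP; split=> [x /existsNP[U /not_implyP[+ /not_implyP[Ux nU]]]|x [n _]].
  rewrite (lorentz_openE tau_ge0 tau_admissible) => oU.
  have mU := measurable_close_open tau_ge0 tau_admissible oU.
  have [e e0 eU] := oU _ Ux.
  have e20 : 0 < e / 2 by lra.
  have [m] := ltr_add_invr e20; rewrite add0r => me.
  have m0 : 0 < m.+1%:R^-1 :> R by rewrite invr_gt0 ltr0n.
  (* Half the radius puts [x] strictly inside the thickening around [a i], while the whole
     thickening stays within [e] of [x]. *)
  have m20 : 0 < m.+1%:R^-1 / 2 :> R by rewrite divr_gt0.
  have [i ix] := aP _ x m20.
  exists (choice.pickle (i, m)) => //; rewrite /F choice.pickleK.
  have bx : ball i m x.
    by exists (a i) => //; exists (m.+1%:R^-1 / 2) => //;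
      rewrite ltr_pdivrMr// ltr_pMr// ltr1n.
  have bU : ball i m `<=` U.
    move=> y [_ -> [r rm iy]]; apply: eU.
    apply: close_le (close_trans (close_sym ix) iy).
    have h : m.+1%:R^-1 / 2 < e / 2.
      by rewrite ltr_pM2r// (lt_trans me)// gtr_pMr// invf_lt1// ltr1n.
    by apply: le_trans (lerD (ltW h) (ltW (lt_trans rm me))) _; lra.
  suff -> : refmeas M (ball i m) == 0%E by [].
  rewrite eq_le measure_ge0 andbT; apply: (@le_trans _ _ (refmeas M U)).
    apply: le_measure => //; rewrite inE//.
    exact: (measurable_close_open tau_ge0 tau_admissible).
  by rewrite leNgt; apply/negP.
rewrite /F; case: choice.unpickle => [[i m]|//]; case: ifPn => // /eqP b0 bx.
move=> /(_ (ball i m)); rewrite b0 ltxx => h; apply: (notF (h _ bx)).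
by rewrite (lorentz_openE tau_ge0 tau_admissible).
Qed.

Lemma measurable_spt : measurable (sptM : set (lborel (@tau R M))).
Proof.
rewrite -[X in measurable X]setCK; apply: measurableC; exact: spt_setC_null.1.
Qed.

Lemma refmeas_setI_spt (A : set (lborel (@tau R M))) : measurable A ->
  refmeas M (sptM `&` A) = refmeas M A.
Proof.
move=> mA; rewrite [RHS](measureDI _ mA measurable_spt) setIC.
rewrite -[LHS]add0e; congr (_ + _)%E; apply/esym.
apply: subset_measure0 spt_setC_null.2 => //.
- exact: measurableD mA measurable_spt.
- exact: spt_setC_null.1.
Qed.

Lemma spt_close_closed (x : M) :
  (forall e : R, 0 < e -> exists2 y, sptM y & close (@tau R M) e x y) -> sptM x.
Proof.
move=> xS U oU Ux.
have : close_open (@tau R M) U by rewrite -(lorentz_openE tau_ge0 tau_admissible).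
by move=> /(_ _ Ux)[e /xS[y Sy xy] eU]; exact: Sy oU (eU _ xy).
Qed.

End support.

(** * The reduced space and its compactness *)

Section reduction.
Variables (R : realType) (M : lorentzian_mmspace R).
Local Notation sptM := (@spt R M).
Local Notation t := (@tau R M).
Local Notation N := (reduced M).
Local Notation tN := (@reduced_tau R M).

(* The map q, extended by a junk value off the support. *)
Definition reduction (x : M) : N :=
  if pselect (x \in sptM) is left h
  then augment (@quotient_tau R M) (quotient_proj (exist _ x h)) else point.

Lemma reduction_tau (x z : M) : sptM x -> sptM z ->
  tN (reduction x) (reduction z) = t x z.
Proof.
rewrite /reduction => Sx Sz.
case: pselect => [hx|[]]; last exact: mem_set.
case: pselect => [hz|[]]; last exact: mem_set.
by rewrite /reduced_tau /augmented_tau /= quotient_tauE.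
Qed.

(** This case split transfers statements from the support of [M] to the reduced space. An adjoined
    [None] falls under the second case. *)
Lemma reduction_onto (y : N) :
  (exists2 x, sptM x & reduction x = y) \/ spacelike_boundary tN y.
Proof.
case: y => -[a|] ha; last by right=> -[[b|] hb].
left; exists (val (repr a)); first by apply: set_mem; exact: valP.
rewrite /reduction; case: pselect => [h|[]]; last exact: valP.
apply: val_inj => /=; congr Some.
rewrite /quotient_proj -[RHS]reprK; congr (\pi_(_) _)%qT.
exact: val_inj.
Qed.

Lemma reduced_measE (A : set (lborel tN)) :
  reduced_meas A = refmeas M (sptM `&` reduction @^-1` A).
Proof.
congr (refmeas M _); apply/seteqP; split=> [_ [[x hx] /= Ax <-]|x [Sx]] /=.
  split; first exact: set_mem hx.
  rewrite /reduction; case: pselect => // h.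
  by rewrite (_ : exist _ x h = exist _ x hx)//; exact: val_inj.
rewrite /reduction /=; case: pselect => [h Ax|[]]; last exact: mem_set.
by exists (exist _ x h).
Qed.

Lemma reduced_tau_ge0 (x y : N) : 0 <= tN x y.
Proof.
have [[x' Sx <-]|bx] := reduction_onto x; last by rewrite (bx y).1.
have [[y' Sy <-]|b_y] := reduction_onto y; last by rewrite (b_y _).2.
by rewrite reduction_tau// tau_ge0.
Qed.

(** In the reduced space closeness is tested only against images of support points, where the values
    agree, and against boundary points, where both values vanish. *)
Lemma close_reduction (e : R) (x y : M) : sptM x -> sptM y ->
  close t e x y -> close tN e (reduction x) (reduction y).
Proof.
move=> Sx Sy xy z; have [[z' Sz <-]|bz] := reduction_onto z.
  by rewrite !reduction_tau//; exact: xy.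
rewrite !(bz _).1 !(bz _).2 subrr normr0; split;
  exact: le_trans (normr_ge0 _) (xy x).1.
Qed.

(** Off the boundary, lift the points to the support. A limit of the lifts stays in the support,
    which is closed, and an escaping family of lifts converges to the boundary point [i0]. *)
Lemma reduced_ultra_lim (I : Type) (U : set_system I) (y : I -> N) :
  UltraFilter U -> exists x, forall e : R, 0 < e -> U [set i | close tN e x (y i)].
Proof.
move=> UU; have [i0 bi0] : exists i0, spacelike_boundary tN i0.
  exact: augmented_boundary.
have [Ub|UNb] := in_ultra_setVsetC [set i | spacelike_boundary tN (y i)] UU.
  exists i0 => e e0; apply: filterS Ub => i /= bi.
  by apply: boundary_close => //; exact: ltW.
have ex i : exists x : M, ~ spacelike_boundary tN (y i) -> sptM x /\ reduction x = y i.
  have [[x Sx xy]|b] := reduction_onto (y i); first by exists x.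
  by exists point.
have [x xP] := choice ex.
have [[z zP]|zP] := admissible_ultra_lim (@tau_ge0 R M) x UU (@tau_admissible R M).
  have Sz : sptM z.
    apply: spt_close_closed => e e0.
    have [i [/xP[Sx _] zi]] := filter_ex (filterI UNb (zP _ e0)).
    by exists (x i).
  exists (reduction z) => e e0;
    apply: filterS2 UNb (zP _ e0) => i /xP[Sx xy] zi /=.
  rewrite -xy; exact: close_reduction.
exists i0 => e e0; apply: filterS2 UNb (zP _ e0) => i /xP[Sx xy] small w /=.
rewrite -xy.
have [-> ->] := bi0 w.
have [[w' Sw <-]|bw] := reduction_onto w.
  rewrite !reduction_tau// !sub0r !normrN !ger0_norm ?tau_ge0//.
  by have [/ltW ? /ltW ?] := small w'.
by rewrite !(bw _).1 !(bw _).2 subrr normr0 ltW.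
Qed.

(** Both coordinates of an ultrafilter of pairs have limits, and joint continuity of [tN] keeps the
    limit pair in the superlevel set. *)
Lemma reduced_admissible : exists T : topology N, admissible_topology tN T.
Proof.
exists (close_topology tN); split; first exact: close_topology_continuous.
move=> e e0; rewrite compact_ultra => U UU Ue /=.
have [x xP] := reduced_ultra_lim fst UU.
have [z zP] := reduced_ultra_lim snd UU.
exists (x, z); split.
  apply/ler_addgt0Pl => r r0.
  have r20 : 0 < r / 2 by lra.
  have [p [ep [xp zp]]] := filter_ex (filterI Ue (filterI (xP _ r20) (zP _ r20))).
  have := close_dist xp zp; rewrite ler_norml /= in ep *; lra.
move=> A [[A1 A2] /= [/close_topology_nbhsP[e1 e10 eA1] /close_topology_nbhsP[e2 e20 eA2]] AA].
apply: filterS2 (xP _ e10) (zP _ e20) => p /eA1 ? /eA2 ?.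
by apply: AA.
Qed.

Lemma measurable_reduction :
  measurable_fun setT (reduction : lborel t -> lborel tN).
Proof.
apply: (measurable_fun_lborel reduced_tau_ge0 reduced_admissible) => U oU.
(* [reduction] is controlled only on the support, so the preimage of [U] need not be open. The open
   set [V] has the same trace on the support; off the support the map is constant. *)
pose V : set (lborel t) := [set y | exists2 x, sptM x /\ U (reduction x) &
  exists2 e : R, forall z, close tN e (reduction x) z -> U z &
    thickening t e [set x] y].
have VE : sptM `&` reduction @^-1` U = sptM `&` V.
  apply/seteqP; split=> y [Sy]; last first.
    move=> [x [Sx Ux] [e eU [_ -> [r re xy]]]]; split=> //; apply: eU.
    by apply: close_reduction => //; apply: close_le xy; exact: ltW.
  move=> Uy; split=> //; have [e e0 eU] := oU _ Uy; exists y => //;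
    exists e => //.
  by exists y => //; exists 0 => //; exact: close_refl.
have mV : measurable V.
  apply: (measurable_close_open (@tau_ge0 R M) (@tau_admissible R M)) => y.
  move=> [x Sx [e eU /close_open_thickening[r r0 rV]]]; exists r => // z /rV ?.
  by exists x => //; exists e.
have -> : reduction @^-1` U =
    (sptM `&` V) `|` (~` sptM `&` [set _ | U point]).
  rewrite -VE; apply/seteqP; split=> [x Ux|x [[//]|[nSx]]].
    have [Sx|nSx] := pselect (sptM x); [by left|right; split=> //].
    by move: Ux; rewrite /= /reduction; case: pselect => // h;
      have := set_mem h.
  by rewrite /= /reduction; case: pselect => // h; have := set_mem h.
apply: measurableU; first exact: measurableI (@measurable_spt R M) mV.
apply: measurableI; first exact: (@spt_setC_null R M).1.
have [Up|nUp] := pselect (U point).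
  by rewrite (_ : [set _ | _] = setT)//; apply/seteqP; split.
by rewrite (_ : [set _ | _] = set0)//; apply/seteqP; split.
Qed.

Lemma reduced_meas_pushforward (A : set (lborel tN)) : measurable A ->
  reduced_meas A = refmeas M (reduction @^-1` A).
Proof.
move=> mA; rewrite reduced_measE refmeas_setI_spt//.
by rewrite -[X in measurable X]setTI; exact: measurable_reduction.
Qed.

(** The boundary is excepted because an adjoined boundary point need not carry mass. Any other ball
    pulls back to a set containing a neighbourhood, within the support, of a support point. *)
Lemma reduced_meas_ball_gt0 (e : R) (x : N) : 0 < e ->
  spacelike_boundary tN x \/ (0 < reduced_meas (close tN e x : set (lborel tN)))%E.
Proof.
move=> e0; have [[z Sz <-]|] := reduction_onto x; [right|by left].
rewrite reduced_measE.
pose V : set (lborel t) := thickening t e [set z].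
have oV : close_open t V by exact: close_open_thickening.
have mV : measurable V by exact: (measurable_close_open (@tau_ge0 R M) (@tau_admissible R M)).
apply: (@lt_le_trans _ _ (refmeas M V)).
  apply: Sz; first by rewrite (lorentz_openE (@tau_ge0 R M) (@tau_admissible R M)).
  by exists z => //; exists 0 => //; exact: close_refl.
rewrite -refmeas_setI_spt//; apply: le_measure; rewrite ?inE.
- exact: measurableI (@measurable_spt R M) mV.
- apply: measurableI (@measurable_spt R M) _.
  rewrite -[X in measurable X]setTI; apply: measurable_reduction => //.
  exact: (measurable_close reduced_tau_ge0 reduced_admissible).
move=> y [Sy [_ -> [r re zy]]]; split=> //=; apply: close_reduction => //.
by apply: close_le zy; exact: ltW.
Qed.

End reduction.

(** * Weak law of large numbers for pairwise independent events *)

Section weak_law_of_large_numbers.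
Context (R : realType) (d : measure_display) (W : measurableType d).
Variables (P : probability W R) (E : nat -> set W) (p : R).
Hypothesis mE : forall i, measurable (E i).
Hypothesis PE : forall i, P (E i) = p%:E.
Hypothesis PEE : forall i j, i != j -> P (E i `&` E j) = (p * p)%:E.

Definition hits (k : nat) : W -> R := fun w => \sum_(i < k) \1_(E i) w.

Lemma hits0 : hits 0 = cst 0.
Proof. by apply/funext => w; rewrite /hits big_ord0. Qed.

Lemma hitsS k : hits k.+1 = hits k \+ \1_(E k).
Proof. by apply/funext => w; rewrite /hits big_ord_recr. Qed.

Lemma Lfun2_indic (A : set W) : measurable A -> (\1_A : W -> R) \in Lfun P 2%:E.
Proof.
move=> mA; rewrite inE /=; apply/andP; split; rewrite inE/=.
  exact: (@measurable_funPT _ _ _ _ (mindic R mA)).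
rewrite /finite_norm unlock poweR_lty//.
under eq_integral => x _.
  have -> : (`|(EFin \o \1_A) x| `^ 2)%E = (\1_A x)%:E :> \bar R.
    rewrite /= indicE; case: (x \in A) => /=; rewrite ?normr1 ?normr0.
      by rewrite powR1.
    by rewrite powR0// pnatr_eq0.
  over.
by rewrite integral_indic//= setIT (le_lt_trans (probability_le1 P mA))// ltry.
Qed.

Let Pfin : P setT \is a fin_num := fin_num_measure P _ measurableT.

Lemma Lfun2_hits k : hits k \in Lfun P 2%:E.
Proof.
elim: k => [|k IHk]; first by rewrite hits0 Lfun_cst.
by rewrite hitsS rpredD ?lee1n//= Lfun2_indic.
Qed.

Lemma covariance_hits k j : (k <= j)%N -> covariance P (hits k) (\1_(E j)) = 0%E.
Proof.
elim: k => [|k IHk] kj; first by rewrite hits0 covariance_cst_l.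
have L2 := Lfun2_indic.
rewrite hitsS covarianceDl ?Lfun2_hits ?L2// IHk ?(ltnW kj)// add0e.
rewrite covarianceE ?Lfun2_mul_Lfun1 ?L2// ?(Lfun_subset12 Pfin) ?L2//.
rewrite (_ : (\1_(E k) * \1_(E j))%R = \1_(E k `&` E j));
  last by rewrite indicI.
rewrite !expectation_indic//; last exact: measurableI.
by rewrite PEE ?(ltn_eqF kj)// !PE -EFinM -EFinB subrr.
Qed.

Lemma expectation_hits k : ('E_P[hits k] = (k%:R * p)%:E)%E.
Proof.
elim: k => [|k IHk]; first by rewrite hits0 expectation_cst mul0r.
rewrite hitsS expectationD ?(Lfun_subset12 Pfin) ?Lfun2_hits ?Lfun2_indic// IHk.
by rewrite expectation_indic// PE -EFinD -natr1 mulrDl mul1r.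
Qed.

(** The indicators are uncorrelated, so their variances add up, and each is [p - p ^+ 2], at most
    1. *)
Lemma variance_hits k : ('V_P[hits k] <= k%:R%:E)%E.
Proof.
elim: k => [|k IHk]; first by rewrite hits0 variance_cst.
rewrite hitsS varianceD ?Lfun2_hits ?Lfun2_indic// covariance_hits// mule0 adde0.
rewrite -natr1 EFinD leeD//.
rewrite -['V_P[_]]/(covariance P (\1_(E k)) (\1_(E k))).
rewrite covarianceE ?Lfun2_mul_Lfun1 ?(Lfun_subset12 Pfin) ?Lfun2_indic//.
rewrite (_ : (\1_(E k) * \1_(E k))%R = \1_(E k));
  last by rewrite -[RHS](congr1 _ (setIid (E k))) indicI.
rewrite !expectation_indic// PE -EFinM -EFinB lee_fin.
have : (p%:E <= 1)%E by rewrite -(PE 0) probability_le1.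
by rewrite lee_fin; have := sqr_ge0 p; lra.
Qed.

Lemma measurable_hits k : measurable_fun setT (hits k).
Proof. by have := Lfun2_hits k; rewrite inE => /andP[/[!inE]]. Qed.

Lemma weak_law k (e : R) : 0 < e ->
  (P [set w | (e <= `|hits k.+1 w / k.+1%:R - p|)%R] <= ((e ^+ 2 * k.+1%:R)^-1)%:E)%E.
Proof.
move=> e0; have k0 : 0 < k.+1%:R :> R by rewrite ltr0n.
pose X : {RV P >-> R} :=
  HB.pack (hits k.+1) (isMeasurableFun.Build _ _ _ _ _ (measurable_hits k.+1)).
have ek0 : 0 < e * k.+1%:R by rewrite mulr_gt0.
have := chebyshev X ek0; rewrite expectation_hits /=.
set A := (X in (P X <= _)%E -> _); set B := (X in _ -> (P X <= _)%E).
have -> : A = B.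
  apply/funext => w; rewrite /A /B /=; congr is_true.
  have -> : hits k.+1 w - k.+1%:R * p = k.+1%:R * (hits k.+1 w / k.+1%:R - p).
    by rewrite mulrBr mulrCA divff ?mulr1// gt_eqF.
  by rewrite normrM (gtr0_norm k0) mulrC ler_pM2l.
move=> /le_trans; apply.
apply: (@le_trans _ _ (((e * k.+1%:R) ^- 2)%:E * k.+1%:R%:E)%E).
  rewrite lee_pmul2l// ?variance_hits// lte_fin invr_gt0 exprn_gt0//.
rewrite -EFinM lee_fin (_ : _ ^- 2 * _ = (e ^+ 2 * k.+1%:R)^-1)//.
by rewrite exprMn [X in (_ * X)^-1]expr2 !invfM -!mulrA mulVf ?mulr1// gt_eqF.
Qed.

End weak_law_of_large_numbers.

(** * Empirical frequencies *)

Section empirical.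
Context (R : realType) (d d' : measure_display).
Variables (W : measurableType d) (T : measurableType d') (P : probability W R).

(** Independence is asked for two indices and one common set: the variance of an empirical frequency
    involves nothing else. *)
Definition pairwise_iid (m : set T -> \bar R) (Y : nat -> W -> T) : Prop :=
  [/\ forall i, measurable_fun setT (Y i),
      forall i A, measurable A -> P (Y i @^-1` A) = m A &
      forall i j A, i != j -> measurable A ->
        P (Y i @^-1` A `&` Y j @^-1` A) = (m A * m A)%E].

Definition frequency (k : nat) (y : nat -> T) (A : set T) : R :=
  (\sum_(i < k) \1_A (y i)) / k%:R.

Lemma frequency_event (m : set T -> \bar R) (Y : nat -> W -> T) (L : seq (set T))
    (e r : R) : pairwise_iid m Y -> (forall A, A \in L -> measurable A) ->
  0 < e -> 0 < r ->
  exists K, forall k, (K <= k)%N -> exists G : set W,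
    [/\ measurable G, (P (~` G) <= r%:E)%E &
        forall w A, G w -> A \in L ->
          `|frequency k (fun i => Y i w) A - fine (m A)| < e].
Proof.
move=> [mY Ym YYm] mL e0; elim: L mL r => [|A L IHL] mL r r0.
  exists 0%N => k _; exists setT; split=> //.
  by rewrite setCT measure0 lee_fin ltW.
have r20 : 0 < r / 2 by lra.
have mA : measurable A by apply: mL; rewrite inE eqxx.
have [K KP] := IHL (fun B BL => mL B (@mem_behead _ (A :: L) B BL)) _ r20.
pose E i := Y i @^-1` A; pose p := fine (m A).
have mE i : measurable (E i) by rewrite /E -[X in measurable X]setTI; exact: mY.
have mAfin : m A \is a fin_num by rewrite -(Ym 0%N)//; apply: fin_num_measure;
  exact: mE.
have PE i : P (E i) = p%:E by rewrite /p fineK// -(Ym i).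
have PEE i j : i != j -> P (E i `&` E j) = (p * p)%:E.
  by move=> ij; rewrite YYm// EFinM /p fineK.
have e2r : 0 < e ^+ 2 * (r / 2) by rewrite mulr_gt0// exprn_gt0.
have [n nP] := ltr_add_invr e2r; rewrite add0r in nP.
(* The bound [n.+1] makes [k] positive and brings the failure probability from [weak_law] below
   [r / 2]. *)
exists (maxn K n.+1) => k; rewrite geq_max => /andP[/KP[G [mG PG GP]]].
case: k GP => // k GP nk.
pose B : set W := [set w | e <= `|@hits R _ _ E k.+1 w / k.+1%:R - p|].
have mB : measurable B.
  have -> : B = (fun w => `|@hits R _ _ E k.+1 w / k.+1%:R - p|) @^-1` `[e, +oo[.
    by apply/seteqP; split=> w /=; rewrite in_itv/= andbT.
  rewrite -[X in measurable X]setTI.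
  suff : measurable_fun setT (fun w => `|@hits R _ _ E k.+1 w / k.+1%:R - p|) by exact.
  apply: measurableT_comp => //; apply: measurable_funB => //.
  by apply: measurable_funM => //; exact: (@measurable_hits _ _ _ P).
exists (G `&` ~` B); split=> [||w A' [Gw Bw]].
- by apply: measurableI => //; exact: measurableC.
- rewrite setCI setCK; apply: (le_trans (measureU2 _ _ _)) => //.
    exact: measurableC.
  rewrite (splitr r) EFinD leeD//.
  apply: (le_trans (weak_law mE PE PEE k e0)); rewrite lee_fin.
  rewrite invfM ler_pdivrMl ?exprn_gt0//; apply: le_trans (ltW nP).
  by rewrite lef_pV2 ?posrE ?ltr0n// ler_nat.
- rewrite inE => /predU1P[->|A'L]; last exact: GP.
  by rewrite ltNge; apply/negP => h; exact: Bw.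
Qed.

End empirical.

(** * Dense samples *)

Section sampling.
Context (R : realType) (d : measure_display) (W : measurableType d).
Variables (P : probability W R) (N : pointedType) (t : N -> N -> R).
Variables (m : set (lborel t) -> \bar R) (Y : nat -> W -> lborel t) (i0 : N).
Hypothesis t_ge0 : forall x y, 0 <= t x y.
Hypothesis t_adm : exists T : topology N, admissible_topology t T.
Hypothesis i0_boundary : spacelike_boundary t i0.
Hypothesis m_ball : forall (e : R) x, 0 < e ->
  spacelike_boundary t x \/ (0 < m (close t e x))%E.
Hypothesis Y_iid : pairwise_iid P m Y.

(** Adding [i0] to the list covers the points with only small values, as these are close to the
    boundary. *)
Lemma totally_bounded (e : R) : 0 < e ->
  exists s : seq N, forall x, exists2 a, a \in s & close t e a x.
Proof.
move=> e0; have [s sP] := admissible_totally_bounded t_ge0 e0 t_adm.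
exists (i0 :: s) => x; have [[a sa ax]|small] := sP x.
  by exists a => //; rewrite inE sa orbT.
exists i0; first by rewrite inE eqxx.
move=> z; have [-> ->] := i0_boundary z; have [/ltW ? /ltW ?] := small z.
by rewrite !sub0r !normrN !ger0_norm.
Qed.

Lemma pairwise_iid_fin_num (A : set (lborel t)) : measurable A -> m A \is a fin_num.
Proof.
case: Y_iid => mY Ym _ mA; rewrite -(Ym 0%N)//; apply: fin_num_measure.
by rewrite -[X in measurable X]setTI; exact: mY.
Qed.

Lemma pairwise_iid_le (A B : set (lborel t)) : measurable A -> measurable B ->
  A `<=` B -> (m A <= m B)%E.
Proof.
case: Y_iid => mY Ym _ mA mB AB; rewrite -!(Ym 0%N)//; apply: le_measure.
- by rewrite inE -[X in measurable X]setTI; exact: mY.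
- by rewrite inE -[X in measurable X]setTI; exact: mY.
- by move=> w; exact: AB.
Qed.

Lemma positive_lower_bound (T : eqType) (s : seq T) (f : T -> R) (e : R) : 0 < e ->
  exists r, [/\ 0 < r, r <= e & forall a, a \in s -> 0 < f a -> r <= f a].
Proof.
move=> e0; elim: s => [|a s [r [r0 re rs]]]; first by exists e; split.
exists (if 0 < f a then Num.min r (f a) else r); split.
- by case: ifP => // fa; rewrite lt_min r0.
- by case: ifP => // fa; rewrite ge_min re.
- move=> b; rewrite inE => /predU1P[->|bs] fb.
    by rewrite fb ge_min lexx orbT.
  by case: ifP => // fa; rewrite ?ge_min rs.
Qed.

(** Around an [e / 4]-net, take the balls of radius [e / 2]. A frequency error below [c], a lower
    bound for their positive masses, forces each ball of positive mass to be hit. A non-boundary [x]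
    lies [e / 4]-close to the centre of such a ball, hence within [3 * e / 4] of a sample point. *)
Lemma dense_sample_event (e r : R) (L : seq (set (lborel t))) :
  0 < e -> 0 < r -> (forall A, A \in L -> measurable A) ->
  exists K, forall k, (K <= k)%N -> exists G : set W,
    [/\ measurable G, (P (~` G) <= r%:E)%E,
        forall w x, G w ->
          spacelike_boundary t x \/ exists i : 'I_k, close t e x (Y i w) &
        forall w A, G w -> A \in L ->
          `|frequency R k (fun i => Y i w) A - fine (m A)| < e].
Proof.
move=> e0 r0 mL.
have e40 : 0 < e / 4 by lra.
have [s sP] := totally_bounded e40.
pose b a : set (lborel t) := close t (e / 2) a.
have mb a : measurable (b a) by exact: measurable_close.
have [c [c0 ce cs]] := positive_lower_bound s (fun a => fine (m (b a))) e0.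
have mL' A : A \in L ++ map b s -> measurable A.
  by rewrite mem_cat => /orP[/mL//|/mapP[a _ ->]].
have [K KP] := frequency_event Y_iid mL' c0 r0.
exists K => k /KP[G [mG PG GP]]; exists G; split=> // [w x Gw|w A Gw AL];
  last first.
  by apply: lt_le_trans ce; apply: GP => //; rewrite mem_cat AL.
have [|mx] := m_ball x e40; [by left|right].
have [a sa ax] := sP x.
have ma : 0 < fine (m (b a)).
  rewrite -lte_fin fineK ?pairwise_iid_fin_num//; apply: (lt_le_trans mx).
  apply: pairwise_iid_le => //; first exact: measurable_close.
  by move=> y xy; apply: close_le (close_trans ax xy); lra.
have freq0 : 0 < frequency R k (fun i => Y i w) (b a).
  have := GP w (b a) Gw; rewrite mem_cat map_f ?orbT// => /(_ isT).
  rewrite ltr_norml => /andP[h _]; have := cs _ sa ma; lra.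
apply: contrapT => /forallNP noi; move: freq0;
  rewrite /frequency big1 ?mul0r ?ltxx//.
move=> i _; rewrite indicE; case: (boolP (_ \in _)) => // /set_mem ai;
  case: (noi i).
by apply: close_le (close_trans (close_sym ax) ai); lra.
Qed.

End sampling.

(** * Approximate isomorphisms from matched samples *)

Section approximate_isomorphisms.
Context (R : realType) (d : measure_display) (W : measurableType d).
Variables (P : probability W R).
Variables (N : pointedType) (t : N -> N -> R) (m : set (lborel t) -> \bar R).
Variables (N' : pointedType) (t' : N' -> N' -> R) (m' : set (lborel t') -> \bar R).

(** The last clause compares masses one-sidedly, in the manner of the Prokhorov distance. It is
    phrased without preimages, so [phi] may be non-measurable. *)
Definition approx_iso (e : R) (L : seq (set (lborel t) * set (lborel t')))
    (phi : N -> N') : Prop :=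
  [/\ forall x z, `|t' (phi x) (phi z) - t x z| <= e,
      forall r x z, close t r x z -> close t' (r + e) (phi x) (phi z) &
      forall B B', (B, B') \in L ->
        (forall x y, B x -> close t' e (phi x) y -> B' y) ->
        (m B <= m' B' + e%:E)%E].

Variables (Y : nat -> W -> lborel t) (Y' : nat -> W -> lborel t').
Variables (i0 : N) (i0' : N').
Hypothesis t_ge0 : forall x y, 0 <= t x y.
Hypothesis t_adm : exists T : topology N, admissible_topology t T.
Hypothesis i0_boundary : spacelike_boundary t i0.
Hypothesis m_ball : forall (e : R) x, 0 < e ->
  spacelike_boundary t x \/ (0 < m (close t e x))%E.
Hypothesis Y_iid : pairwise_iid P m Y.
Hypothesis t_ge0' : forall x y, 0 <= t' x y.
Hypothesis t_adm' : exists T : topology N', admissible_topology t' T.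
Hypothesis i0_boundary' : spacelike_boundary t' i0'.
Hypothesis m_ball' : forall (e : R) x, 0 < e ->
  spacelike_boundary t' x \/ (0 < m' (close t' e x))%E.
Hypothesis Y_iid' : pairwise_iid P m' Y'.
Hypothesis eq_law : forall k (A : set (borel_mx R k)), measurable A ->
  P ((fun w => kernel_mx t (fun i : 'I_k => Y i w)) @^-1` A) =
  P ((fun w => kernel_mx t' (fun i : 'I_k => Y' i w)) @^-1` A).

(* Two good events of probability at least 2/3 and equality of laws give a pair
   of good samples with almost equal matrices. *)
Lemma matching_samples (e : R) (L : seq (set (lborel t)))
    (L' : seq (set (lborel t'))) : 0 < e ->
  (forall A, A \in L -> measurable A) -> (forall A, A \in L' -> measurable A) ->
  exists k (y : nat -> N) (y' : nat -> N'),
    [/\ forall i j : 'I_k, `|t (y i) (y j) - t' (y' i) (y' j)| < e,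
        forall x, spacelike_boundary t x \/ exists i : 'I_k, close t e x (y i),
        forall x, spacelike_boundary t' x \/ exists i : 'I_k, close t' e x (y' i),
        forall A, A \in L -> `|frequency R k (y : nat -> lborel t) A - fine (m A)| < e &
        forall A, A \in L' -> `|frequency R k (y' : nat -> lborel t') A - fine (m' A)| < e].
Proof.
move=> e0 mL mL'.
have r0 : 0 < 3^-1 :> R by lra.
have [K KP] := dense_sample_event t_ge0 t_adm i0_boundary m_ball Y_iid e0 r0 mL.
have [K' KP'] := dense_sample_event t_ge0' t_adm' i0_boundary' m_ball' Y_iid' e0 r0 mL'.
pose k := maxn K K'.
have [G [mG PG Gd Gf]] := KP k (leq_maxl _ _).
have [G' [mG' PG' Gd' Gf']] := KP' k (leq_maxr _ _).
pose T w := kernel_mx t (fun i : 'I_k => Y i w).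
pose T' w := kernel_mx t' (fun i : 'I_k => Y' i w).
(* [C] is open as a union of balls. Its preimage under [T] contains [G], so has probability at least
   2/3; by equality of laws so has its preimage under [T'], which must then meet [G']. *)
pose C : set (borel_mx R k) :=
  [set A : 'M[R]_k | exists2 w, G w & ball (T w) e A].
have mC : measurable C.
  apply: sub_sigma_algebra; rewrite /= (_ : C = \bigcup_(w in G) ball (T w) e).
    by apply: bigcup_open => w _; exact: ball_open.
  by apply/seteqP; split=> A [w]; exists w.
have mT : measurable (T @^-1` C).
  rewrite -[X in measurable X]setTI.
  by apply: (measurable_kernel_mx t_ge0 t_adm) => // i; case: Y_iid.
have mT' : measurable (T' @^-1` C).
  rewrite -[X in measurable X]setTI.
  by apply: (measurable_kernel_mx t_ge0' t_adm') => // i; case: Y_iid'.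
have [w' [Gw' [w Gw ww']]] : exists w', G' w' /\ C (T' w').
  apply: contrapT => /forallNP no.
  have h1 : (P (T' @^-1` C) <= (3^-1)%:E)%E.
    apply: le_trans PG'; apply: le_measure; rewrite ?inE//.
      exact: measurableC.
    by move=> w' Cw' Gw'; apply: (no w').
  have h2 : (P (~` (T @^-1` C)) <= (3^-1)%:E)%E.
    apply: le_trans PG; apply: le_measure; rewrite ?inE//;
      try exact: measurableC.
    apply: subsetC => w Gw; exists w => //; exact: ballxx.
  have := probability_setC P mT; rewrite [P (T @^-1` C)]eq_law// => h3.
  have : (P (T' @^-1` C) + P (~` (T @^-1` C)) <= (3^-1)%:E + (3^-1)%:E)%E by exact: leeD.
  rewrite h3 addeCA subee ?adde0 ?fin_num_measure//.
  by rewrite -EFinD lee_fin; lra.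
exists k, (fun i => Y i w), (fun i => Y' i w'); split=> //.
- by move=> i j; have [_ /(_ i j)] := ww'; rewrite !mxE.
- by move=> x; exact: Gd.
- by move=> x; exact: Gd'.
- by move=> A; exact: Gf.
- by move=> A; exact: Gf'.
Qed.

Lemma approx_iso_exists (e : R) (L : seq (set (lborel t) * set (lborel t'))) :
  0 < e -> (forall B B', (B, B') \in L -> measurable B /\ measurable B') ->
  exists phi, approx_iso e L phi.
Proof.
move=> e0 mL; have [r r0 er] : exists2 r : R, 0 < r & e = 8 * r by exists (e / 8); lra.
have mL1 A : A \in map fst L -> measurable A by case/mapP => -[B B'] /mL[? _] ->.
have mL2 A : A \in map snd L -> measurable A by case/mapP => -[B B'] /mL[_ ?] ->.
have [k [y [y' [match_ yd yd' yf yf']]]] := matching_samples r0 mL1 mL2.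
(* The index [None] adds the boundary points to the samples, which makes them [r]-dense
   everywhere. *)
pose z (a : option 'I_k) := if a is Some i then y i else i0.
pose z' (a : option 'I_k) := if a is Some i then y' i else i0'.
have zz' a b : `|t (z a) (z b) - t' (z' a) (z' b)| <= r.
  move: a b => [i|] [j|] /=; first exact/ltW/match_.
  - by rewrite (i0_boundary _).2 (i0_boundary' _).2 subrr normr0 ltW.
  - by rewrite (i0_boundary _).1 (i0_boundary' _).1 subrr normr0 ltW.
  - by rewrite (i0_boundary _).1 (i0_boundary' _).1 subrr normr0 ltW.
have zd x : exists a, close t r x (z a).
  have [b|[i xi]] := yd x; last by exists (Some i).
  by exists None; apply: boundary_close => //; exact: ltW.
have zd' x : exists a, close t' r x (z' a).
  have [b|[i xi]] := yd' x; last by exists (Some i).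
  by exists None; apply: boundary_close => //; exact: ltW.
(* An arbitrary test point [w] is replaced by a sample point [z' c]. The loss [4 * r] consists of
   two density errors and two matrix errors. *)
have transfer q a b : close t q (z a) (z b) -> close t' (q + 4 * r) (z' a) (z' b).
  move=> ab w; have [c wc] := zd' w.
  have [h1 h2] := ab (z c).
  have [_ g1] := wc (z' a); have [_ g2] := wc (z' b).
  have [g3 _] := wc (z' a); have [g4 _] := wc (z' b).
  have := zz' a c; have := zz' b c; have := zz' c a; have := zz' c b.
  move: h1 h2 g1 g2 g3 g4; rewrite !ler_norml.
  move=> /andP[? ?] /andP[? ?] /andP[? ?] /andP[? ?] /andP[? ?] /andP[? ?].
  move=> /andP[? ?] /andP[? ?] /andP[? ?] /andP[? ?].
  by split; apply/andP; split; lra.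
have [iota iotaP] := choice zd.
exists (fun x => z' (iota x)); split.
- move=> x x'; have := close_dist (iotaP x) (iotaP x').
  have := zz' (iota x) (iota x'); rewrite !ler_norml => /andP[? ?] /andP[? ?].
  by apply/andP; split; lra.
- move=> q x x' xx'.
  have := close_trans (close_trans (close_sym (iotaP x)) xx') (iotaP x').
  by move=> /transfer; apply: close_le; lra.
move=> B B' BL BB'; have [mB mB'] := mL _ _ BL.
have fB := pairwise_iid_fin_num Y_iid mB.
have fB' := pairwise_iid_fin_num Y_iid' mB'.
rewrite -(fineK fB) -(fineK fB') -EFinD lee_fin.
(* If [y i] lies in [B], then [y' i] is within [5 * r] of the image of [y i], hence lies in [B']:
   hits of [B] are hits of [B']. *)
have : frequency R k (y : nat -> lborel t) B <= frequency R k (y' : nat -> lborel t') B'.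
  rewrite /frequency ler_wpM2r ?invr_ge0//; apply: ler_sum => i _.
  rewrite !indicE ler_nat; case: (boolP (y i \in B)) => // /set_mem Bi.
  rewrite (_ : (y' i \in B') = true)//; apply/mem_set/(BB' (y i)) => //.
  have /transfer : close t r (z (iota (y i))) (z (Some i)) by exact/close_sym.
  by apply: close_le; lra.
have := yf B (map_f fst BL); have := yf' B' (map_f snd BL).
rewrite !ltr_norml => /andP[? ?] /andP[? ?] ?; lra.
Qed.

End approximate_isomorphisms.

(** * Passage to the limit *)

Lemma close_lim (R : realType) (N : choiceType) (t : N -> N -> R) (r : R) (x y : N) :
  (forall e, 0 < e -> close t (r + e) x y) -> close t r x y.
Proof.
by move=> xy z; split; apply/ler_addgt0Pr => e /xy/(_ z)[].
Qed.

Section thickening.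
Context (R : realType) (N : pointedType) (t : N -> N -> R).
Hypothesis t_ge0 : forall x y, 0 <= t x y.
Hypothesis t_adm : exists T : topology N, admissible_topology t T.

(** A closed set is the decreasing intersection of its thickenings, so continuity from above
    applies. *)
Lemma cvg_thickening (nu : probability (lborel t) R) (C : set N) :
  close_open t (~` C) ->
  nu (thickening t n.+1%:R^-1 C : set (lborel t)) @[n --> \oo] -->
  nu (C : set (lborel t)).
Proof.
move=> oC; pose V n : set (lborel t) := thickening t n.+1%:R^-1 C.
have mV n : measurable (V n).
  by apply: measurable_close_open => //; exact: close_open_thickening.
have VC : \bigcap_n V n = C.
  apply/seteqP; split=> [y Vy|y Cy n _]; last first.
    by apply: (@close_thickening _ _ _ _ 0 y) => //; exact: close_refl.
  apply: contrapT => /oC[e e0 eC].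
  have [n] := ltr_add_invr e0; rewrite add0r => ne.
  have [c Cc [r rn cy]] := Vy n I; apply: (eC c) => //.
  by apply: close_sym; apply: close_le cy; exact: ltW (lt_trans rn ne).
have := @nonincreasing_cvg_mu _ _ _ nu V; rewrite VC; apply=> //.
- by rewrite (le_lt_trans (probability_le1 _ _)) ?ltry.
- by rewrite -VC; exact: bigcapT_measurable.
move=> n k nk; apply/subsetPset => y [c Cc [r rk cy]].
exists c => //; exists r => //; apply: lt_le_trans rk _.
by rewrite lef_pV2 ?posrE ?ltr0n// ler_nat.
Qed.

End thickening.

Section limit_isomorphism.
Context (R : realType).
Variables (N : pointedType) (t : N -> N -> R) (mu : probability (lborel t) R).
Variables (N' : pointedType) (t' : N' -> N' -> R).
Variable mu' : probability (lborel t') R.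
Hypothesis t_ge0 : forall x y, 0 <= t x y.
Hypothesis t_adm : exists T : topology N, admissible_topology t T.
Hypothesis t_tb : forall e : R, 0 < e ->
  exists s : seq N, forall x, exists2 a, a \in s & close t e a x.
Hypothesis t_ge0' : forall x y, 0 <= t' x y.
Hypothesis t_adm' : exists T : topology N', admissible_topology t' T.
Hypothesis t_lim' : forall (I : Type) (U : set_system I) (y : I -> N'),
  UltraFilter U -> exists x, forall e : R, 0 < e -> U [set i | close t' e x (y i)].
Local Notation pairs := (seq (set (lborel t) * set (lborel t'))).
Definition measurable_pairs (L : pairs) :=
  forall B B', (B, B') \in L -> measurable B /\ measurable B'.
Hypothesis approx : forall (e : R) (L : pairs), 0 < e -> measurable_pairs L ->
  exists phi, approx_iso mu mu' e L phi.

Lemma approx_iso_sub (e e' : R) (L L' : pairs) (phi : N -> N') :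
  e <= e' -> {subset L' <= L} ->
  approx_iso mu mu' e L phi -> approx_iso mu mu' e' L' phi.
Proof.
move=> ee' LL' [h1 h2 h3]; split=> [x z|r x z /h2|B B' /LL' BL BB'].
- exact: le_trans (h1 x z) ee'.
- by apply: close_le; rewrite lerD2l.
- apply: (le_trans (h3 _ _ BL _)); last by rewrite leeD2l// lee_fin.
  by move=> x y Bx xy; apply: (BB' x) => //; exact: close_le xy.
Qed.

(** Taking the smaller tolerance and concatenating the lists shows that these sets form a filter
    base. An ultrafilter above it handles all tolerances and all pairs at once. *)
Lemma approx_iso_ultra : exists2 U : set_system (N -> N'), UltraFilter U &
  forall (e : R) (L : pairs), 0 < e -> measurable_pairs L ->
    U (approx_iso mu mu' e L).
Proof.
have FF : ProperFilter (filter_from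
    [set q : R * pairs | 0 < q.1 /\ measurable_pairs q.2]
    (fun q => approx_iso mu mu' q.1 q.2)).
  apply: filter_from_proper => [|[e L] [/= e0 mL]]; last exact: approx.
  apply: filter_from_filter; first by exists (1, [::]).
  move=> [e1 L1] [e2 L2] [/= e10 mL1] [/= e20 mL2].
  exists (Num.min e1 e2, L1 ++ L2) => /=.
    split; first by rewrite lt_min e10.
    by move=> B B'; rewrite mem_cat => /orP[/mL1|/mL2].
  move=> phi h; split; apply: approx_iso_sub h; rewrite ?ge_min ?lexx ?orbT//.
    by move=> q qL; rewrite mem_cat qL.
  by move=> q qL; rewrite mem_cat qL orbT.
have [U [UU FU]] := ultraFilterLemma FF.
by exists U => // e L e0 mL; apply: FU; exists (e, L).
Qed.

Lemma limit_isomorphism : exists phi : lborel t -> lborel t',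
  [/\ measurable_fun setT phi,
      forall x z, t x z = t' (phi x) (phi z) &
      forall A, measurable A -> mu (phi @^-1` A) = mu' A].
Proof.
have [U UU Uapp] := approx_iso_ultra.
have nil_pairs : measurable_pairs [::] by [].
(* [phi] is the pointwise limit of the approximate isomorphisms along [U]. *)
have [phi phiP] := choice (fun x : N => t_lim' (fun psi => psi x) UU).
have phi_tau x z : t x z = t' (phi x) (phi z).
  apply/eqP; rewrite -subr_eq0 -normr_le0; apply/ler_addgt0Pr => e e0.
  have e40 : 0 < e / 4 by lra.
  have [psi [[h _ _] [hx hz]]] := filter_ex (filterI (Uapp _ _ e40 nil_pairs)
    (filterI (phiP x _ e40) (phiP z _ e40))).
  have := close_dist hx hz; have := h x z; rewrite !ler_norml.
  by move=> /andP[? ?] /andP[? ?]; apply/andP; split; lra.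
have phi_close r x z : close t r x z -> close t' r (phi x) (phi z).
  move=> xz; apply: close_lim => e e0.
  have e40 : 0 < e / 4 by lra.
  have [psi [[_ h _] [hx hz]]] := filter_ex (filterI (Uapp _ _ e40 nil_pairs)
    (filterI (phiP x _ e40) (phiP z _ e40))).
  have := close_trans (close_trans hx (h _ _ _ xz)) (close_sym hz).
  by apply: close_le; lra.
(* Convergence on a finite net becomes uniform, since [phi] and almost every [psi] do not expand
   closeness by more than a small error. *)
have phi_unif e : 0 < e -> U [set psi | forall x, close t' e (phi x) (psi x)].
  move=> e0; have e40 : 0 < e / 4 by lra.
  have [s sP] := t_tb e40.
  have Us : U [set psi | forall a, a \in s -> close t' (e / 4) (phi a) (psi a)].
    elim: s {sP} => [|a s IHs]; first by apply: filterS filterT.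
    apply: filterS2 IHs (phiP a _ e40) => psi /= hs ha b.
    by rewrite inE => /predU1P[->|/hs].
  apply: filterS2 Us (Uapp _ _ e40 nil_pairs) => psi hs [_ h _] x.
  have [a sa ax] := sP x.
  have := close_trans (close_trans (close_sym (phi_close _ _ _ ax)) (hs a sa)) (h _ _ _ ax).
  by apply: close_le; lra.
have phi_open O : close_open t' O -> close_open t (phi @^-1` O).
  by move=> oO x /oO[e e0 eO]; exists e => // z /phi_close/eO.
have mphi : measurable_fun setT (phi : lborel t -> lborel t').
  apply: measurable_fun_lborel => // O /phi_open; exact: measurable_close_open.
pose F : {mfun lborel t >-> lborel t'} :=
  HB.pack (phi : lborel t -> lborel t') (isMeasurableFun.Build _ _ _ _ _ mphi).
pose nu : probability (lborel t') R := distribution mu F.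
have mclosed (C : set N') : close_open t' (~` C) -> measurable (C : set (lborel t')).
  move=> oC; rewrite -[X in measurable X]setCK; apply: measurableC.
  exact: measurable_close_open.
(* For closed [C], apply the mass clause to the preimage of [C] and the thickening [V]: a [psi]
   uniformly near [phi] maps the former well inside [V]. Then let the thickening shrink. *)
have nu_le C : close_open t' (~` C) -> (nu C <= mu' (C : set (lborel t')))%E.
  move=> oC.
  have cv : (mu' (thickening t' n.+1%:R^-1 C : set (lborel t')) + (n.+1%:R^-1)%:E)%E
      @[n --> \oo] --> (mu' (C : set (lborel t')) + 0)%E.
    apply: cvgeD; [exact: fin_num_adde_defl|exact: cvg_thickening|].
    exact: cvge_harmonic.
  rewrite adde0 in cv; apply: cvge_ge cv; apply: nearW => n.
  have : 0 < n.+1%:R^-1 :> R by rewrite invr_gt0 ltr0n.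
  move: (n.+1%:R^-1 : R) => e e0.
  pose V : set (lborel t') := thickening t' e C.
  have mV : measurable V.
    by apply: measurable_close_open => //; exact: close_open_thickening.
  have mL : measurable_pairs [:: (phi @^-1` C : set (lborel t), V)].
    move=> B B'; rewrite inE => /eqP[-> ->]; split=> //.
    by rewrite -[X in measurable X]setTI;
      exact: (mphi measurableT _ (mclosed _ oC)).
  have e40 : 0 < e / 4 by lra.
  have [psi [[_ _ h] hu]] := filter_ex (filterI (Uapp _ _ e40 mL) (phi_unif _ e40)).
  apply: (@le_trans _ _ (mu' V + (e / 4)%:E)%E); last first.
    by rewrite leeD2l// lee_fin; lra.
  apply: h; first by rewrite inE eqxx.
  move=> x y Cx xy; apply: (@close_thickening _ _ _ _ (e / 2) (phi x)) => //.
    lra.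
  by have := close_trans (hu x) xy; apply: close_le; lra.
(* Applied to the closed complement of a thickening [V], [nu_le] bounds [mu' V] by [nu V], and [V]
   shrinks to [C]. *)
have nu_eq C : close_open t' (~` C) -> nu C = mu' (C : set (lborel t')).
  move=> oC; apply/eqP; rewrite eq_le nu_le//=.
  have := @cvg_thickening _ _ _ t_ge0' t_adm' nu C oC; apply: cvge_ge;
    apply: nearW => n.
  pose V : set (lborel t') := thickening t' n.+1%:R^-1 C.
  have oV : close_open t' V by exact: close_open_thickening.
  have mV : measurable V by exact: measurable_close_open.
  apply: (@le_trans _ _ (mu' V)).
    apply: le_measure; rewrite ?inE//; first exact: mclosed.
    move=> y Cy; apply: (@close_thickening _ _ _ _ 0 y) => //;
      exact: close_refl.
  have : (nu (~` V) <= mu' (~` V))%E by apply: nu_le; rewrite setCK.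
  rewrite !probability_setC//.
  have f1 : nu V \is a fin_num by exact: fin_num_measure.
  have f2 : mu' V \is a fin_num by exact: fin_num_measure.
  rewrite -(fineK f1) -(fineK f2) -!EFinB !lee_fin; lra.
exists phi; split=> // A mA; rewrite -[LHS]/(nu A).
apply: (@measure_unique _ R (lborel t') (lorentz_open t') (fun=> setT) erefl
  _ _ _ nu mu' _ _ A mA).
- move=> B C; rewrite lorentz_openE//; exact: close_openI.
- by move=> _; rewrite lorentz_openE//; exact: close_openT.
- by rewrite bigcup_const.
- move=> B oB'; have oB : close_open t' B by rewrite -lorentz_openE.
  have mB : measurable (B : set (lborel t')) by exact: measurable_close_open.
  have : nu (~` B) = mu' (~` B) by apply: nu_eq; rewrite setCK.
  rewrite !probability_setC//.
  have f1 : nu B \is a fin_num by exact: fin_num_measure.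
  have f2 : mu' B \is a fin_num by exact: fin_num_measure.
  rewrite -(fineK f1) -(fineK f2) -!EFinB => -[h].
  suff : (fine (nu B))%:E = (fine (mu' B))%:E by rewrite !fineK.
  by congr (_%:E); lra.
- by move=> _; rewrite (le_lt_trans (probability_le1 _ _)) ?ltry.
Qed.

End limit_isomorphism.

(** * Null sets and finite families of an i.i.d. sequence *)

Lemma eq_measure_off_null (R : realType) (d : measure_display)
    (W : measurableType d) (P : {measure set W -> \bar R}) (A B Z : set W) :
  measurable A -> measurable B -> measurable Z -> P Z = 0%E ->
  A `\` Z = B `\` Z -> P A = P B.
Proof.
move=> mA mB mZ PZ AB; rewrite (measureDI _ mA mZ) (measureDI _ mB mZ) AB.
congr (_ + _)%E; transitivity (0 : \bar R)%E; last apply/esym.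
- apply: subset_measure0 PZ => //; first exact: measurableI.
- apply: subset_measure0 PZ => //; first exact: measurableI.
Qed.

Section iid.
Context (R : realType) (d d' : measure_display).
Variables (W : measurableType d) (T : measurableType d') (P : probability W R).
Variables (X : nat -> {RV P >-> T}) (m : probability T R).
Hypothesis iidX : iid_with_law X m.

Lemma iid_law i A : measurable A -> P (X i @^-1` A) = m A.
Proof. exact: iidX.2. Qed.

Lemma iid_fset (J : {fset nat}) (s : seq nat) (B : nat -> set T) :
  uniq s -> J =i s -> (forall i, measurable (B i)) ->
  P (\bigcap_(i in [set` J]) (X i @^-1` B i)) = (\prod_(i <- s) m (B i))%E.
Proof.
move=> us Js mB; rewrite iidX.1//.
rewrite (perm_big s) /=; last by apply: uniq_perm => //; exact: fset_uniq.
by apply: eq_bigr => i _; exact: iid_law.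
Qed.

Lemma iid_rect k (B : 'I_k -> set T) : (forall i, measurable (B i)) ->
  P (\bigcap_(i : 'I_k) (X i @^-1` B i)) = (\prod_(i < k) m (B i))%E.
Proof.
move=> mB; pose C (l : nat) : set T := if insub l is Some i then B i else setT.
have CE (i : 'I_k) : C i = B i by rewrite /C valK.
pose J : {fset nat} := [fset l in iota 0 k]%fset.
have JE : J =i iota 0 k by move=> l; rewrite !inE.
have mC l : measurable (C l) by rewrite /C; case: insub.
have := iid_fset (iota_uniq 0 k) JE mC.
have -> : \bigcap_(l in [set` J]) (X l @^-1` C l) = \bigcap_(i : 'I_k) (X i @^-1` B i).
  apply/seteqP; split=> w h.
    move=> i _ /=; rewrite -CE; apply: (h (i : nat)) => /=.
    by rewrite JE mem_iota /=.
  move=> l /=; rewrite JE mem_iota /= add0n => lk.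
  by have := h (Ordinal lk) I; rewrite -CE.
move=> ->; rewrite -[iota 0 k](congr1 (iota 0) (subn0 k)) -/(index_iota 0 k) big_mkord.
by apply: eq_bigr => i _; rewrite CE.
Qed.

Lemma iid_pair i j A : i != j -> measurable A ->
  P (X i @^-1` A `&` X j @^-1` A) = (m A * m A)%E.
Proof.
move=> ij mA; pose J : {fset nat} := [fset i; j]%fset.
have JE : J =i [:: i; j] by move=> l; rewrite !inE.
have uij : uniq [:: i; j] by rewrite /= inE ij.
have := iid_fset uij JE (fun=> mA); rewrite !big_cons big_nil mule1 => <-.
congr (P _); apply/seteqP; split=> [w [wi wj] l /=|w h].
  by rewrite JE !inE => /orP[] /eqP ->.
by split; apply: h; rewrite /= JE !inE eqxx ?orbT.
Qed.

End iid.

(** * The sequence in the reduced space *)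

Section reduced_sequence.
Context (R : realType) (M : lorentzian_mmspace R) (d : measure_display).
Variables (W : measurableType d) (P : probability W R).
Variable X : nat -> {RV P >-> lborel (@tau R M)}.
Hypothesis iidX : iid_with_law X (refmeas M).
Local Notation tN := (@reduced_tau R M).

Definition reduced_rv (i : nat) (w : W) : lborel tN := reduction (X i w).

HB.instance Definition _ := isMeasurableFun.Build _ _ _ _
  (@reduction R M : lborel (@tau R M) -> lborel tN) (@measurable_reduction R M).

(** The junk value of [reduction] is harmless because the complement of the support is null; this
    presents [reduced_meas] as a genuine probability on measurable sets. *)
Definition reduced_prob : probability (lborel tN) R :=
  distribution (refmeas M) (@reduction R M : lborel (@tau R M) -> lborel tN).

Lemma reduced_meas_prob (A : set (lborel tN)) : measurable A ->
  reduced_meas A = reduced_prob A.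
Proof. exact: reduced_meas_pushforward. Qed.

Lemma measurable_reduced_rv i : measurable_fun setT (reduced_rv i).
Proof. exact: (measurableT_comp (@measurable_reduction R M)). Qed.

Lemma measurable_preimage_reduction (A : set (lborel tN)) : measurable A ->
  measurable (@reduction R M @^-1` A : set (lborel (@tau R M))).
Proof.
by move=> mA; rewrite -[X in measurable X]setTI; exact: measurable_reduction.
Qed.

Lemma reduced_rv_iid : pairwise_iid P reduced_prob reduced_rv.
Proof.
split=> [i|i A mA|i j A ij mA]; first exact: measurable_reduced_rv.
- exact: (iid_law iidX _ (measurable_preimage_reduction mA)).
- exact: (iid_pair iidX ij (measurable_preimage_reduction mA)).
Qed.

(** The two matrices agree unless some [X i] leaves the support, which happens on a countable union
    of null events. *)
Lemma law_tau_mx_reduced k (A : set (borel_mx R k)) : measurable A ->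
  P ((fun w => tau_mx (fun i : 'I_k => X i w)) @^-1` A) =
  P ((fun w => kernel_mx tN (fun i : 'I_k => reduced_rv i w)) @^-1` A).
Proof.
move=> mA; pose Z : set W := \bigcup_i (X i @^-1` (~` @spt R M)).
have mXS i : measurable (X i @^-1` (~` @spt R M)).
  by rewrite -[X in measurable X]setTI; apply: measurable_funPT => //;
    exact: (@spt_setC_null R M).1.
apply: (@eq_measure_off_null _ _ _ P _ _ Z).
- rewrite -[X in measurable X]setTI.
  by apply: (measurable_kernel_mx (@tau_ge0 R M) (@tau_admissible R M)).
- rewrite -[X in measurable X]setTI.
  apply: (measurable_kernel_mx (@reduced_tau_ge0 R M) (@reduced_admissible R M)) => //.
  by move=> i; exact: measurable_reduced_rv.
- exact: bigcupT_measurable.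
- apply/negligibleP; first exact: bigcupT_measurable.
  apply: negligible_bigcup => i; apply/(negligibleP _ (mXS i)).
  by have [mS S0] := @spt_setC_null R M; rewrite -S0;
    exact: (iid_law iidX i mS).
apply/seteqP.
have key w : ~ Z w -> tau_mx (fun i : 'I_k => X i w) =
    kernel_mx tN (fun i : 'I_k => reduced_rv i w).
  move=> nZ; have S i : spt (X (i : 'I_k) w).
    by apply: contrapT => nS; apply: nZ; exists (i : nat).
  by apply/matrixP => i j; rewrite !mxE reduction_tau.
split=> w [/= Aw nZ]; split=> //=; first by rewrite -key.
by rewrite key.
Qed.

End reduced_sequence.

(** * Isomorphy and equality of the matrix laws *)

Theorem theorem1p3 (R : realType) (M M' : lorentzian_mmspace R)
  (d : measure_display) (Omega : measurableType d) (P : probability Omega R)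
  (X : nat -> {RV P >-> lborel (@tau R M)})
  (X' : nat -> {RV P >-> lborel (@tau R M')})
  (iidX : iid_with_law X (refmeas M))
  (iidX' : iid_with_law X' (refmeas M')) :
  isomorphic M M' <->
  (forall k : nat,
    eq_in_law P
      ((fun w : Omega => tau_mx (fun i : 'I_k => X i w)) : Omega -> borel_mx R k)
      ((fun w : Omega => tau_mx (fun i : 'I_k => X' i w)) : Omega -> borel_mx R k)).
Proof.
split=> [[iota [miota iota_tau iota_meas]] k A mA|eq_law].
  rewrite /pushforward (law_tau_mx_reduced iidX mA) (law_tau_mx_reduced iidX' mA).
  pose Z (i : 'I_k) (w : Omega) := iota (reduced_rv X i w).
  pose Z' (i : 'I_k) (w : Omega) := reduced_rv X' i w.
  (* As [iota] preserves distances, both matrices are written with the kernel of [M'], and it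
     remains to compare rectangle probabilities. These are products of equal masses, since [iota]
     also preserves the measures. *)
  have -> : (fun w => kernel_mx (@reduced_tau R M) (fun i : 'I_k => reduced_rv X i w))
      = (fun w => kernel_mx (@reduced_tau R M') (fun i : 'I_k => Z i w)).
    by apply/funext => w; apply/matrixP => i j; rewrite !mxE iota_tau.
  apply: (@eq_law_kernel_mx _ _ (@reduced_tau R M') _ _ P k Z Z') => //.
  - exact: reduced_tau_ge0.
  - exact: reduced_admissible.
  - by move=> i; apply: (measurableT_comp miota); exact: measurable_reduced_rv.
  - by move=> i; exact: measurable_reduced_rv.
  move=> B mB.
  have mB' i : measurable (iota @^-1` B i).
    by rewrite -[X in measurable X]setTI; exact: miota.
  have := iid_rect iidX (fun i => measurable_preimage_reduction (mB' i)).
  have := iid_rect iidX' (fun i => measurable_preimage_reduction (mB i)).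
  move=> h' h; rewrite [LHS]h [RHS]h'; apply: eq_bigr => i _.
  by rewrite -!reduced_meas_pushforward//; exact: iota_meas.
have [i0 i0P] : exists i0 : reduced M, spacelike_boundary (@reduced_tau R M) i0.
  exact: augmented_boundary.
have [i0' i0P'] : exists i0 : reduced M', spacelike_boundary (@reduced_tau R M') i0.
  exact: augmented_boundary.
have mball (M0 : lorentzian_mmspace R) (e : R) (x : reduced M0) : 0 < e ->
    spacelike_boundary (@reduced_tau R M0) x \/
    (0 < reduced_prob M0 (close (@reduced_tau R M0) e x))%E.
  move=> e0; rewrite -reduced_meas_prob; first exact: reduced_meas_ball_gt0.
  exact: (measurable_close (@reduced_tau_ge0 R M0) (@reduced_admissible R M0)).
have [|iota [miota iota_tau iota_meas]] :=
  @limit_isomorphism R _ _ (reduced_prob M) _ _ (reduced_prob M')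
    (@reduced_tau_ge0 R M) (@reduced_admissible R M)
    (totally_bounded (@reduced_tau_ge0 R M) (@reduced_admissible R M) i0P)
    (@reduced_tau_ge0 R M') (@reduced_admissible R M') (@reduced_ultra_lim R M').
  move=> e L e0 mL.
  apply: (approx_iso_exists (@reduced_tau_ge0 R M) (@reduced_admissible R M) i0P
    (@mball M) (reduced_rv_iid iidX) (@reduced_tau_ge0 R M') (@reduced_admissible R M')
    i0P' (@mball M') (reduced_rv_iid iidX')) => // k A mA.
  have := eq_law k A mA; rewrite /pushforward.
  by rewrite (law_tau_mx_reduced iidX mA) (law_tau_mx_reduced iidX' mA).
exists iota; split=> // A mA; rewrite /pushforward !reduced_meas_prob//.
  exact: iota_meas.
by rewrite -[X in measurable X]setTI; exact: miota.
Qed.
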